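(* The algebraic variety $\mathcal V=\mathcal V_1=\{V_1(x)\}$, equipped with the maps $e_k^c$, $\gamma_k$, $\varepsilon_k$ for $k\in I=\{0,1,2,3,4,5\}$ described in the context (those for $k=1,\dots,5$ given by explicit formulas, those for $k=0$ defined through $\bar\sigma$), is a positive geometric crystal for the affine Lie algebra $\mathfrak g=D_5^{(1)}$, and the $0$-structure is given explicitly as follows. Put $$B=\frac{x_2^{(2)}x_3^{(1)}}{x_3^{(3)}}+\frac{x_3^{(2)}x_3^{(1)}}{x_5^{(2)}},\qquad C=\frac{x_2^{(2)}x_2^{(1)}}{x_4^{(2)}}+\frac{x_2^{(2)}x_4^{(1)}x_2^{(1)}}{x_3^{(3)}x_3^{(2)}},\qquad A=B+C .$$ Then $$\gamma_0(V_1(x))=\frac{1}{x_2^{(2)}x_2^{(1)}},\qquad \varepsilon_0(V_1(x))=x_5^{(1)}+A,$$ and $e_0^c(V_1(x))=V_1(x')$ where $$x_4^{(2)\prime}=x_4^{(2)}\cdot\frac{c\Big(x_5^{(1)}+B+\frac{x_2^{(2)}x_4^{(1)}x_2^{(1)}}{x_3^{(3)}x_3^{(2)}}\Big)+\frac{x_2^{(2)}x_2^{(1)}}{x_4^{(2)}}}{c(x_5^{(1)}+A)},$$ $$x_3^{(3)\prime}=x_3^{(3)}\cdot\frac{c\Big(x_5^{(1)}+\frac{x_3^{(2)}x_3^{(1)}}{x_5^{(2)}}\Big)+\frac{x_2^{(2)}x_3^{(1)}}{x_3^{(3)}}+C}{c(x_5^{(1)}+A)},$$ $$x_2^{(2)\prime}=\frac{x_2^{(2)}}{c},\qquad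 x_5^{(2)\prime}=x_5^{(2)}\cdot\frac{cx_5^{(1)}+A}{c(x_5^{(1)}+A)},$$ $$x_3^{(2)\prime}=x_3^{(2)}\cdot\frac{c(x_5^{(1)}+B)+C}{c\Big(c\big(x_5^{(1)}+\frac{x_3^{(2)}x_3^{(1)}}{x_5^{(2)}}\big)+\frac{x_2^{(2)}x_3^{(1)}}{x_3^{(3)}}+C\Big)},$$ $$x_4^{(1)\prime}=x_4^{(1)}\cdot\frac{x_5^{(1)}+A}{c\Big(x_5^{(1)}+B+\frac{x_2^{(2)}x_4^{(1)}x_2^{(1)}}{x_3^{(3)}x_3^{(2)}}\Big)+\frac{x_2^{(2)}x_2^{(1)}}{x_4^{(2)}}},$$ $$x_1^{(1)\prime}=\frac{x_1^{(1)}}{c},\qquad x_2^{(1)\prime}=\frac{x_2^{(1)}}{c},\qquad x_3^{(1)\prime}=x_3^{(1)}\cdot\frac{x_5^{(1)}+A}{c(x_5^{(1)}+B)+C},\qquad x_5^{(1)\prime}=x_5^{(1)}\cdot\frac{x_5^{(1)}+A}{cx_5^{(1)}+A}.$$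
   Context: **Cartan matrix.** $\mathfrak g=D_5^{(1)}$, $I=\{0,1,2,3,4,5\}$, with Cartan matrix $(a_{ij})_{i,j\in I}$ symmetric, $a_{ii}=2$, $a_{ij}=-1$ for $\{i,j\}\in\{\{0,2\},\{1,2\},\{2,3\},\{3,4\},\{3,5\}\}$, and $a_{ij}=0$ otherwise. **Geometric crystal** (simply laced case). A quadruple $(X,\{e_i\}_{i\in I},\{\gamma_i\}_{i\in I},\{\varepsilon_i\}_{i\in I})$ where $X$ is an ind-variety, $e_i:\mathbb C^\times\times X\to X$, $(c,x)\mapsto e_i^c(x)$, are rational $\mathbb C^\times$-actions and $\gamma_i,\varepsilon_i:X\to\mathbb C$ are rational functions satisfying: (1) $\{1\}\times X\subset\mathrm{dom}(e_i)$ for any $i\in I$, where $\mathrm{dom}(e_i)$ is the domain of definition of $e_i$; (2) $\gamma_j(e_i^c(x))=c^{a_{ij}}\gamma_j(x)$; (3) $e_i^{c_1}e_j^{c_2}=e_j^{c_2}e_i^{c_1}$ if $a_{ij}=a_{ji}=0$, and $e_i^{c_1}e_j^{c_1c_2}e_i^{c_2}=e_j^{c_2}e_i^{c_1c_2}e_j^{c_1}$ if $a_{ij}=a_{ji}=-1$; (4) $\varepsilon_i(e_i^c(x))=c^{-1}\varepsilon_i(x)$, and $\varepsilon_i(e_j^c(x))=\varepsilon_i(x)$ if $a_{ij}=a_{ji}=0$. It is *positive* if it has a positive structure; roughly speaking, this means that the rational maps $e_i^c$, $\varepsilon_i$, $\gamma_i$ are given by ratios of polynomial functions with positive coefficients (here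 in the coordinates $x\in(\mathbb C^\times)^{10}$ and $c$). **The module $W(\varpi_5)$.** The $16$-dimensional $D_5^{(1)}$-module with basis $\{(i_1,\dots,i_5): i_j\in\{+,-\},\ i_1i_2i_3i_4i_5=+\}$. The operator $f_0$ changes $(i_1,i_2)=(-,-)$ to $(+,+)$; for $1\le k\le4$, $f_k$ changes $(i_k,i_{k+1})=(+,-)$ to $(-,+)$; $f_5$ changes $(i_4,i_5)=(+,+)$ to $(-,-)$; in all other cases $f_k$ gives $0$. For a basis vector $v$, $\langle\check\alpha_k,\mathrm{wt}(v)\rangle$ equals $1$ if $f_kv\ne0$, $-1$ if $v$ is the image of a basis vector under $f_k$, and $0$ otherwise. For $c\in\mathbb C^\times$ let $c^{\check\alpha_k}v=c^{\langle\check\alpha_k,\mathrm{wt}(v)\rangle}v$ and $Y_k(c)=(1+\frac{f_k}{c})c^{\check\alpha_k}$. **Varieties.** $\mathcal V_1$ is the set of all $$V_1(x)=Y_4(x_4^{(2)})Y_3(x_3^{(3)})Y_2(x_2^{(2)})Y_5(x_5^{(2)})Y_3(x_3^{(2)})Y_4(x_4^{(1)})Y_1(x_1^{(1)})Y_2(x_2^{(1)})Y_3(x_3^{(1)})Y_5(x_5^{(1)})(+,+,+,+,+),$$ with $x=(x_4^{(2)},x_3^{(3)},x_2^{(2)},x_5^{(2)},x_3^{(2)},x_4^{(1)},x_1^{(1)},x_2^{(1)},x_3^{(1)},x_5^{(1)})\in(\mathbb C^\times)^{10}$; $\mathcal V_2$ is the set of all $$V_2(y)=Y_5(y_5^{(2)})Y_3(y_3^{(3)})Y_2(y_2^{(2)})Y_4(y_4^{(2)})Y_3(y_3^{(2)})Y_5(y_5^{(1)})Y_0(y_0^{(1)})Y_2(y_2^{(1)})Y_3(y_3^{(1)})Y_4(y_4^{(1)})(-,+,+,+,-),$$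 with all $y_m^{(l)}\in\mathbb C^\times$. **Structure on $\mathcal V_1$ for $k=1,\dots,5$.** $e_k^c(V_1(x))$ is $V_1$ of the tuple obtained from $x$ by changing only the following coordinates: - $k=1$: $x_1^{(1)}\mapsto cx_1^{(1)}$; - $k=2$: $x_2^{(2)}\mapsto c_2x_2^{(2)}$, $x_2^{(1)}\mapsto\frac{c}{c_2}x_2^{(1)}$; - $k=3$: $x_3^{(3)}\mapsto c_{3_1}x_3^{(3)}$, $x_3^{(2)}\mapsto c_{3_2}x_3^{(2)}$, $x_3^{(1)}\mapsto\frac{c}{c_{3_1}c_{3_2}}x_3^{(1)}$; - $k=4$: $x_4^{(2)}\mapsto c_4x_4^{(2)}$, $x_4^{(1)}\mapsto\frac{c}{c_4}x_4^{(1)}$; - $k=5$: $x_5^{(2)}\mapsto c_5x_5^{(2)}$, $x_5^{(1)}\mapsto\frac{c}{c_5}x_5^{(1)}$; where $$c_2=\frac{cx_2^{(2)}x_2^{(1)}+x_3^{(2)}x_1^{(1)}}{x_2^{(2)}x_2^{(1)}+x_3^{(2)}x_1^{(1)}},\quad c_4=\frac{cx_4^{(2)}x_4^{(1)}+x_3^{(3)}x_3^{(2)}}{x_4^{(2)}x_4^{(1)}+x_3^{(3)}x_3^{(2)}},\quad c_5=\frac{cx_5^{(2)}x_5^{(1)}+x_3^{(2)}x_3^{(1)}}{x_5^{(2)}x_5^{(1)}+x_3^{(2)}x_3^{(1)}},$$ $$c_{3_1}=\frac{cT_1+T_2+T_3}{T_1+T_2+T_3},\quad c_{3_2}=\frac{cT_1+cT_2+T_3}{cT_1+T_2+T_3},$$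 $$T_1=x_3^{(3)}(x_3^{(2)})^2x_3^{(1)},\quad T_2=x_2^{(2)}x_5^{(2)}x_3^{(2)}x_3^{(1)},\quad T_3=x_2^{(2)}x_5^{(2)}x_4^{(1)}x_2^{(1)}.$$ Moreover $$\gamma_1=\tfrac{(x_1^{(1)})^2}{x_2^{(2)}x_2^{(1)}},\ \gamma_2=\tfrac{(x_2^{(2)}x_2^{(1)})^2}{x_3^{(3)}x_3^{(2)}x_1^{(1)}x_3^{(1)}},\ \gamma_3=\tfrac{(x_3^{(3)}x_3^{(2)}x_3^{(1)})^2}{x_4^{(2)}x_2^{(2)}x_5^{(2)}x_4^{(1)}x_2^{(1)}x_5^{(1)}},\ \gamma_4=\tfrac{(x_4^{(2)}x_4^{(1)})^2}{x_3^{(3)}x_3^{(2)}x_3^{(1)}},\ \gamma_5=\tfrac{(x_5^{(2)}x_5^{(1)})^2}{x_3^{(3)}x_3^{(2)}x_3^{(1)}},$$ $$\varepsilon_1=\tfrac{x_2^{(2)}}{x_1^{(1)}},\quad \varepsilon_2=\tfrac{x_3^{(3)}}{x_2^{(2)}}\Big(1+\tfrac{x_3^{(2)}x_1^{(1)}}{x_2^{(2)}x_2^{(1)}}\Big),\quad \varepsilon_3=\tfrac{x_4^{(2)}}{x_3^{(3)}}\Big(1+\tfrac{x_2^{(2)}x_5^{(2)}}{x_3^{(3)}x_3^{(2)}}+\tfrac{x_2^{(2)}x_5^{(2)}x_4^{(1)}x_2^{(1)}}{x_3^{(3)}(x_3^{(2)})^2x_3^{(1)}}\Big),$$ $$\varepsilon_4=\tfrac{1}{x_4^{(2)}}\Big(1+\tfrac{x_3^{(3)}x_3^{(2)}}{x_4^{(2)}x_4^{(1)}}\Big),\quad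 \varepsilon_5=\tfrac{x_3^{(3)}}{x_5^{(2)}}\Big(1+\tfrac{x_3^{(2)}x_3^{(1)}}{x_5^{(2)}x_5^{(1)}}\Big)$$ (all evaluated at $V_1(x)$). It is known that with these, $\mathcal V_1$ is a positive geometric crystal for the subalgebra $\mathfrak g_0$ with index set $\{1,\dots,5\}$. **The map $\bar\sigma$.** $\bar\sigma:\mathcal V_1\to\mathcal V_2$ is the birational isomorphism $V_1(x)\mapsto V_2(y)$ with $$y_5^{(2)}=\tfrac1{x_5^{(1)}},\quad y_5^{(1)}=\tfrac1{x_5^{(2)}},\quad y_0^{(1)}=\tfrac{x_4^{(2)}x_4^{(1)}}{x_5^{(2)}x_5^{(1)}},\quad y_4^{(2)}=\tfrac{x_1^{(1)}}{x_5^{(2)}x_5^{(1)}}Q,\quad y_4^{(1)}=Q^{-1},\quad y_3^{(3)}=\tfrac1{x_5^{(1)}}D,$$ $$y_3^{(2)}=\tfrac{1}{x_5^{(2)}x_5^{(1)}}D^{-1}A,\quad y_3^{(1)}=\tfrac{x_2^{(2)}x_2^{(1)}}{x_5^{(2)}}A^{-1},\quad y_2^{(2)}=\tfrac1{x_5^{(1)}}N,\quad y_2^{(1)}=\tfrac{x_3^{(3)}x_3^{(2)}x_3^{(1)}}{(x_5^{(2)})^2x_5^{(1)}}N^{-1},$$ where $Q=\frac{x_5^{(2)}}{x_3^{(3)}}+\frac{x_3^{(2)}}{x_2^{(2)}}+\frac{x_2^{(1)}}{x_1^{(1)}}$, $D=\frac{x_2^{(2)}}{x_3^{(3)}}+\frac{x_3^{(2)}}{x_5^{(2)}}$,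 $N=\frac{x_3^{(3)}x_3^{(2)}}{x_4^{(2)}x_5^{(2)}}+\frac{x_4^{(1)}}{x_5^{(2)}}$ and $A$ is as in the claim. **Definition of the $0$-structure on $\mathcal V_1$.** On $\mathcal V_2$ let $\bar e_5^c(V_2(y))$ be obtained by $y_5^{(2)}\mapsto\bar c_5y_5^{(2)}$, $y_5^{(1)}\mapsto\frac{c}{\bar c_5}y_5^{(1)}$ (other coordinates unchanged), with $\bar c_5=\frac{cy_5^{(2)}y_5^{(1)}+y_3^{(3)}y_3^{(2)}}{y_5^{(2)}y_5^{(1)}+y_3^{(3)}y_3^{(2)}}$, and let $\bar\gamma_5(V_2(y))=\frac{(y_5^{(2)})^2(y_5^{(1)})^2}{y_3^{(3)}y_3^{(2)}y_3^{(1)}}$, $\bar\varepsilon_5(V_2(y))=\frac1{y_5^{(2)}}\Big(1+\frac{y_3^{(3)}y_3^{(2)}}{y_5^{(2)}y_5^{(1)}}\Big)$. Then $$e_0^c:=\bar\sigma^{-1}\circ\bar e_5^c\circ\bar\sigma,\qquad \gamma_0:=\bar\gamma_5\circ\bar\sigma,\qquad \varepsilon_0:=\bar\varepsilon_5\circ\bar\sigma .$$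
   Formalization: Axiom (1), {1}×X ⊂ dom(e_i), fails literally on V_1 (for e_2 where x_2^(2)x_2^(1)+x_3^(2)x_1^(1)=0); it is replaced by: e_i^1 is defined on all of X, and the set of x with (1,x) in dom(e_i) is open and dense in X. *)

(* Defs.v *)
From HB Require Import structures.
From mathcomp Require Import all_boot all_order all_algebra.
From mathcomp Require Import mpoly complex.
From mathcomp Require Import classical_sets reals.

Set Implicit Arguments.
Unset Strict Implicit.
Unset Printing Implicit Defensive.

Import Order.TTheory GRing.Theory Num.Theory.
Local Open Scope classical_set_scope.
Local Open Scope ring_scope.

Definition aff (K : fieldType) (J : finType) : Type := {ffun J -> K}.

Definition peval (K : fieldType) (J : finType) (p : {mpoly K[#|J|]})
  (v : aff K J) : K := p.@[fun i => v (enum_val i)].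

Definition zclosed (K : fieldType) (J : finType) (Z : set (aff K J)) : Prop :=
  exists P : set {mpoly K[#|J|]},
    Z = [set v | forall p, P p -> peval p v = 0].

Definition zopen (K : fieldType) (J : finType) (O : set (aff K J)) : Prop :=
  zclosed (~` O).

Definition irreducible_variety (K : fieldType) (J : finType)
    (X : set (aff K J)) : Prop :=
  [/\ exists O Z, [/\ zopen O, zclosed Z & X = O `&` Z],
      X !=set0
    & forall Z1 Z2, zclosed Z1 -> zclosed Z2 ->
        X `<=` Z1 `|` Z2 -> X `<=` Z1 \/ X `<=` Z2].

Definition open_dense (K : fieldType) (J : finType)
    (X U : set (aff K J)) : Prop :=
  (exists2 O, zopen O & U = X `&` O) /\
  (forall O, zopen O -> X `&` O !=set0 -> U `&` O !=set0).

Definition rat_eval (K : fieldType) (J J' : finType)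
    (num den : J' -> {mpoly K[#|J|]}) (v : aff K J) : aff K J' :=
  [ffun j => peval (num j) v / peval (den j) v].

(* A rational map X ⇢ Y is given by (the graph of) a partial function F.     *)
(* [ratdom X Y F] is the domain of definition of the rational map which F    *)
(* represents: the set of points near which F extends to a morphism into Y.  *)
(* It can be larger than the set of points at which F itself is defined.     *)
Definition ratdom (K : fieldType) (J J' : finType) (X : set (aff K J))
    (Y : set (aff K J')) (F : aff K J -> aff K J' -> Prop) : set (aff K J) :=
  [set v | X v /\ exists O num den, [/\ zopen O, O v
    & forall u, X u -> O u ->
        [/\ forall j : J', peval (den j) u != 0,
            Y (rat_eval num den u)
          & forall w, F u w -> w = rat_eval num den u]]].

Record rational_map (K : fieldType) (J J' : finType) (X : set (aff K J))
    (Y : set (aff K J')) (F : aff K J -> aff K J' -> Prop) : Prop := {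
  ratmap_open_dense : open_dense X [set v | X v /\ exists w, F v w];
  ratmap_functional : forall v w w', X v -> F v w -> F v w' -> w = w';
  ratmap_codomain : forall v w, X v -> F v w -> Y w;
  ratmap_regular : forall v w, X v -> F v w -> ratdom X Y F v
}.

Definition rational_function (K : fieldType) (J : finType)
    (X : set (aff K J)) (f : aff K J -> K -> Prop) : Prop :=
  rational_map X setT (fun v (w : aff K unit) => f v (w tt)).

Definition ratmap_eq (K : fieldType) (J : finType) (T : Type)
    (X : set (aff K J)) (F G : aff K J -> T -> Prop) : Prop :=
  exists2 U, open_dense X U & forall v, U v -> exists w, F v w /\ G v w.

Definition rcomp (A B C : Type) (G : B -> C -> Prop) (F : A -> B -> Prop) :
  A -> C -> Prop := fun a c => exists2 b, F a b & G b c.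

Definition rinv (A B : Type) (F : A -> B -> Prop) : B -> A -> Prop :=
  fun b a => F a b.

Definition graph_on (A B : Type) (X : set A) (f : A -> B) : A -> B -> Prop :=
  fun a b => X a /\ b = f a.

Definition birational (K : fieldType) (J J' : finType) (X : set (aff K J))
    (Y : set (aff K J')) (F : aff K J -> aff K J' -> Prop) : Prop :=
  rational_map X Y F /\
  exists G, [/\ rational_map Y X G,
                ratmap_eq X (rcomp G F) (fun v w => w = v)
              & ratmap_eq Y (rcomp F G) (fun v w => w = v)].

Definition torus (K : fieldType) (J : finType) : set (aff K J) :=
  [set x | forall j, x j != 0].
Arguments torus : clear implicits.

(* Points of K × K^J; the coordinate in K has index None.                    *)
Definition gm_part (K : fieldType) (J : finType) (u : aff K (option J)) : K :=
  u None.
Definition aff_part (K : fieldType) (J : finType) (u : aff K (option J)) :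
  aff K J := [ffun j => u (Some j)].
Definition apair (K : fieldType) (J : finType) (c : K) (v : aff K J) :
  aff K (option J) := [ffun o => if o is Some j then v j else c].

Definition Gm_times (K : fieldType) (J : finType) (X : set (aff K J)) :
    set (aff K (option J)) :=
  [set u | gm_part u != 0 /\ X (aff_part u)].

Definition uncurried (K : fieldType) (J J' : finType)
    (e : K -> aff K J -> aff K J' -> Prop) :
  aff K (option J) -> aff K J' -> Prop := fun u w => e (gm_part u) (aff_part u) w.

(* The condition "{1} × X ⊂ dom(e_i)" is rendered by [gc_one] (for c = 1 the *)
(* rational map e_i^1 of X is everywhere defined) and [gc_dom] (the domain   *)
(* of e_i as a rational map on Gm × X meets {1} × X in an open dense         *)
(* subset). For e_2 on the variety V1 below, (1, V1 x) is not in the latter  *)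
(* domain when x_2^(2) x_2^(1) + x_3^(2) x_1^(1) = 0, so that "open dense"   *)
(* cannot be replaced by "all".                                              *)
Record geometric_crystal (K : fieldType) (I : finType) (a : I -> I -> int)
    (J : finType) (X : set (aff K J))
    (e : I -> K -> aff K J -> aff K J -> Prop)
    (gamma epsilon : I -> aff K J -> K -> Prop) : Prop := {
  gc_variety : irreducible_variety X;
  gc_e_rational : forall i, rational_map (Gm_times X) X (uncurried (e i));
  gc_e_one : forall i, ratmap_eq X (e i 1) (fun v w => w = v);
  gc_e_mul : forall i c1 c2, c1 != 0 -> c2 != 0 ->
    ratmap_eq X (rcomp (e i c1) (e i c2)) (e i (c1 * c2));
  gc_gamma_rational : forall i, rational_function X (gamma i);
  gc_epsilon_rational : forall i, rational_function X (epsilon i);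
  gc_one : forall i, X `<=` ratdom X X (e i 1);
  gc_dom : forall i,
    open_dense X [set v | ratdom (Gm_times X) X (uncurried (e i)) (apair 1 v)];
  gc_gamma : forall i j c, c != 0 ->
    ratmap_eq X (rcomp (gamma j) (e i c))
             (fun v b => exists2 b0, gamma j v b0 & b = c ^ (a i j) * b0);
  gc_comm : forall i j c1 c2, c1 != 0 -> c2 != 0 ->
    a i j = 0 -> a j i = 0 ->
    ratmap_eq X (rcomp (e i c1) (e j c2)) (rcomp (e j c2) (e i c1));
  gc_braid : forall i j c1 c2, c1 != 0 -> c2 != 0 ->
    a i j = -1 -> a j i = -1 ->
    ratmap_eq X (rcomp (e i c1) (rcomp (e j (c1 * c2)) (e i c2)))
             (rcomp (e j c2) (rcomp (e i (c1 * c2)) (e j c1)));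
  gc_epsilon : forall i c, c != 0 ->
    ratmap_eq X (rcomp (epsilon i) (e i c))
             (fun v b => exists2 b0, epsilon i v b0 & b = c^-1 * b0);
  gc_epsilon_comm : forall i j c, c != 0 -> a i j = 0 -> a j i = 0 ->
    ratmap_eq X (rcomp (epsilon i) (e j c)) (epsilon i)
}.

(* On R[i], 0 < z means that z is a positive real.                           *)
Definition positive_poly (K : numFieldType) (n : nat) (p : {mpoly K[n]}) :
  Prop := p != 0 /\ forall m, m \in msupp p -> 0 < p@_m.

Definition positive_map (K : numFieldType) (J J' : finType)
    (X : set (aff K J)) (F : aff K J -> aff K J' -> Prop) : Prop :=
  exists num den : J' -> {mpoly K[#|J|]},
    (forall j, positive_poly (num j) /\ positive_poly (den j)) /\
    ratmap_eq X F (fun v w => (forall j, peval (den j) v != 0) /\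
                           w = rat_eval num den v).

Definition positive_function (K : numFieldType) (J : finType)
    (X : set (aff K J)) (f : aff K J -> K -> Prop) : Prop :=
  positive_map X (fun v (w : aff K unit) => f v (w tt)).

Record positive_structure (K : numFieldType) (I J : finType)
    (X : set (aff K J)) (e : I -> K -> aff K J -> aff K J -> Prop)
    (gamma epsilon : I -> aff K J -> K -> Prop)
    (J0 : finType) (theta : aff K J0 -> aff K J) : Prop := {
  ps_birational :
    birational (torus K J0) X (graph_on (torus K J0) theta);
  ps_e : forall i, positive_map (Gm_times (torus K J0))
    (uncurried (fun c => rcomp (rinv (graph_on (torus K J0) theta))
                     (rcomp (e i c) (graph_on (torus K J0) theta))));
  ps_gamma : forall i, positive_function (torus K J0)
    (rcomp (gamma i) (graph_on (torus K J0) theta));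
  ps_epsilon : forall i, positive_function (torus K J0)
    (rcomp (epsilon i) (graph_on (torus K J0) theta))
}.

Definition D5_edges : seq (nat * nat) :=
  [:: (0, 2); (1, 2); (2, 3); (3, 4); (3, 5)]%N.

Definition D5_cartan (i j : 'I_6) : int :=
  if i == j then 2
  else if ((val i, val j) \in D5_edges) || ((val j, val i) \in D5_edges)
       then -1 else 0.

(* Signs are booleans, with true for +.                                      *)
Definition signs : Type := (bool * bool * bool * bool * bool)%type.

Definition sign_prod (s : signs) : bool :=
  let: (i1, i2, i3, i4, i5) := s in
  ~~ (~~ i1 (+) ~~ i2 (+) ~~ i3 (+) ~~ i4 (+) ~~ i5).

Definition spin : finType :=
  {s : bool * bool * bool * bool * bool | sign_prod s}.

Definition fmove (k : nat) (s : signs) : option signs :=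
  match k, s with
  | 0, (false, false, i3, i4, i5) => Some (true, true, i3, i4, i5)
  | 1, (true, false, i3, i4, i5) => Some (false, true, i3, i4, i5)
  | 2, (i1, true, false, i4, i5) => Some (i1, false, true, i4, i5)
  | 3, (i1, i2, true, false, i5) => Some (i1, i2, false, true, i5)
  | 4, (i1, i2, i3, true, false) => Some (i1, i2, i3, false, true)
  | 5, (i1, i2, i3, true, true) => Some (i1, i2, i3, false, false)
  | _, _ => None
  end.

Definition farrow (k : nat) (s t : spin) : bool :=
  fmove k (val s) == Some (val t).

Definition f_op (K : fieldType) (k : nat) (v : aff K spin) : aff K spin :=
  [ffun t => \sum_(s | farrow k s t) v s].

Definition wt (k : nat) (s : spin) : int :=
  if [exists t, farrow k s t] then 1
  else if [exists t, farrow k t s] then -1 else 0.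

Definition coroot_act (K : fieldType) (k : nat) (c : K) (v : aff K spin) :
  aff K spin := [ffun s => c ^ (wt k s) * v s].

Definition Y (K : fieldType) (k : nat) (c : K) (v : aff K spin) :
    aff K spin :=
  let u := coroot_act k c v in [ffun s => u s + f_op k u s / c].

Definition basis_vec (K : fieldType) (s : signs) : aff K spin :=
  [ffun t => (val t == s)%:R].

(* xml stands for x_m^(l), and yml for y_m^(l). The coordinates of x and y   *)
(* are numbered in their order of occurrence in V1(x) and V2(y):             *)
(*   x = (x42, x33, x22, x52, x32, x41, x11, x21, x31, x51),                 *)
(*   y = (y52, y33, y22, y42, y32, y51, y01, y21, y31, y41).                 *)

Definition vec10 (K : fieldType) (s : seq K) : aff K 'I_10 :=
  [ffun i : 'I_10 => s`_i].

Definition with_coords (K : fieldType) (T : Type)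
    (f : K -> K -> K -> K -> K -> K -> K -> K -> K -> K -> T)
    (x : aff K 'I_10) : T :=
  let x_ k (h : (k < 10)%N) := x (Ordinal h) in
  f (x_ 0%N isT) (x_ 1%N isT) (x_ 2%N isT) (x_ 3%N isT) (x_ 4%N isT)
    (x_ 5%N isT) (x_ 6%N isT) (x_ 7%N isT) (x_ 8%N isT) (x_ 9%N isT).

Definition V1 (K : fieldType) : aff K 'I_10 -> aff K spin :=
  with_coords (fun x42 x33 x22 x52 x32 x41 x11 x21 x31 x51 =>
    Y 4 x42 (Y 3 x33 (Y 2 x22 (Y 5 x52 (Y 3 x32 (Y 4 x41 (Y 1 x11
      (Y 2 x21 (Y 3 x31 (Y 5 x51
        (basis_vec K (true, true, true, true, true)))))))))))).

Definition V2 (K : fieldType) : aff K 'I_10 -> aff K spin :=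
  with_coords (fun y52 y33 y22 y42 y32 y51 y01 y21 y31 y41 =>
    Y 5 y52 (Y 3 y33 (Y 2 y22 (Y 4 y42 (Y 3 y32 (Y 5 y51 (Y 0 y01
      (Y 2 y21 (Y 3 y31 (Y 4 y41
        (basis_vec K (false, true, true, true, false)))))))))))).

Definition V1_var (K : fieldType) : set (aff K spin) :=
  @V1 K @` torus K 'I_10.
Arguments V1_var : clear implicits.

(* The partial map V(x) |-> V'(phi(x)). As 0^-1 = 0, in each formula for phi *)
(* used below a vanishing denominator makes some coordinate of phi(x) equal  *)
(* to 0, so the condition that phi(x) be in the torus also ensures that all  *)
(* denominators are nonzero.                                                 *)
Definition chart_map (K : fieldType) (J : finType)
    (V V' : aff K 'I_10 -> aff K J) (phi : aff K 'I_10 -> aff K 'I_10) :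
    aff K J -> aff K J -> Prop :=
  fun v w => exists x, [/\ torus K 'I_10 x, torus K 'I_10 (phi x),
                           v = V x & w = V' (phi x)].

Definition chart_fun (K : fieldType) (J : finType)
    (V : aff K 'I_10 -> aff K J) (f : aff K 'I_10 -> K) :
    aff K J -> K -> Prop :=
  fun v b => exists x, [/\ torus K 'I_10 x, v = V x & b = f x].

Definition e_coord (K : fieldType) (k : nat) (c : K) :
    aff K 'I_10 -> aff K 'I_10 :=
  with_coords (fun x42 x33 x22 x52 x32 x41 x11 x21 x31 x51 =>
    let c2 := (c * x22 * x21 + x32 * x11) / (x22 * x21 + x32 * x11) in
    let c4 := (c * x42 * x41 + x33 * x32) / (x42 * x41 + x33 * x32) in
    let c5 := (c * x52 * x51 + x32 * x31) / (x52 * x51 + x32 * x31) in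
    let T1 := x33 * x32 ^+ 2 * x31 in
    let T2 := x22 * x52 * x32 * x31 in
    let T3 := x22 * x52 * x41 * x21 in
    let c31 := (c * T1 + T2 + T3) / (T1 + T2 + T3) in
    let c32 := (c * T1 + c * T2 + T3) / (c * T1 + T2 + T3) in
    match k with
    | 1 => vec10 [:: x42; x33; x22; x52; x32; x41; c * x11; x21; x31; x51]
    | 2 => vec10 [:: x42; x33; c2 * x22; x52; x32; x41; x11; c / c2 * x21;
                     x31; x51]
    | 3 => vec10 [:: x42; c31 * x33; x22; x52; c32 * x32; x41; x11; x21;
                     c / (c31 * c32) * x31; x51]
    | 4 => vec10 [:: c4 * x42; x33; x22; x52; x32; c / c4 * x41; x11; x21;
                     x31; x51]
    | 5 => vec10 [:: x42; x33; x22; c5 * x52; x32; x41; x11; x21; x31;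
                     c / c5 * x51]
    | _ => vec10 [:: x42; x33; x22; x52; x32; x41; x11; x21; x31; x51]
    end).

Definition gamma_coord (K : fieldType) (k : nat) : aff K 'I_10 -> K :=
  with_coords (fun x42 x33 x22 x52 x32 x41 x11 x21 x31 x51 =>
    match k with
    | 1 => x11 ^+ 2 / (x22 * x21)
    | 2 => (x22 * x21) ^+ 2 / (x33 * x32 * x11 * x31)
    | 3 => (x33 * x32 * x31) ^+ 2 / (x42 * x22 * x52 * x41 * x21 * x51)
    | 4 => (x42 * x41) ^+ 2 / (x33 * x32 * x31)
    | 5 => (x52 * x51) ^+ 2 / (x33 * x32 * x31)
    | _ => 0
    end).

Definition epsilon_coord (K : fieldType) (k : nat) : aff K 'I_10 -> K :=
  with_coords (fun x42 x33 x22 x52 x32 x41 x11 x21 x31 x51 =>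
    match k with
    | 1 => x22 / x11
    | 2 => x33 / x22 * (1 + x32 * x11 / (x22 * x21))
    | 3 => x42 / x33 * (1 + x22 * x52 / (x33 * x32)
             + x22 * x52 * x41 * x21 / (x33 * x32 ^+ 2 * x31))
    | 4 => 1 / x42 * (1 + x33 * x32 / (x42 * x41))
    | 5 => x33 / x52 * (1 + x32 * x31 / (x52 * x51))
    | _ => 0
    end).

Definition B_coord (K : fieldType) : aff K 'I_10 -> K :=
  with_coords (fun x42 x33 x22 x52 x32 x41 x11 x21 x31 x51 =>
    x22 * x31 / x33 + x32 * x31 / x52).

Definition C_coord (K : fieldType) : aff K 'I_10 -> K :=
  with_coords (fun x42 x33 x22 x52 x32 x41 x11 x21 x31 x51 =>
    x22 * x21 / x42 + x22 * x41 * x21 / (x33 * x32)).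

Definition A_coord (K : fieldType) (x : aff K 'I_10) : K :=
  B_coord x + C_coord x.

Definition sigma_coord (K : fieldType) (x : aff K 'I_10) : aff K 'I_10 :=
  let A := A_coord x in
  with_coords (fun x42 x33 x22 x52 x32 x41 x11 x21 x31 x51 =>
    let Q := x52 / x33 + x32 / x22 + x21 / x11 in
    let D := x22 / x33 + x32 / x52 in
    let N := x33 * x32 / (x42 * x52) + x41 / x52 in
    let y52 := 1 / x51 in
    let y51 := 1 / x52 in
    let y01 := x42 * x41 / (x52 * x51) in
    let y42 := x11 / (x52 * x51) * Q in
    let y41 := Q^-1 in
    let y33 := 1 / x51 * D in
    let y32 := 1 / (x52 * x51) * D^-1 * A in
    let y31 := x22 * x21 / x52 * A^-1 in
    let y22 := 1 / x51 * N in
    let y21 := x33 * x32 * x31 / (x52 ^+ 2 * x51) * N^-1 in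
    vec10 [:: y52; y33; y22; y42; y32; y51; y01; y21; y31; y41]) x.

Definition sigma_bar (K : fieldType) : aff K spin -> aff K spin -> Prop :=
  chart_map (@V1 K) (@V2 K) (@sigma_coord K).

Definition ebar5_coord (K : fieldType) (c : K) : aff K 'I_10 -> aff K 'I_10 :=
  with_coords (fun y52 y33 y22 y42 y32 y51 y01 y21 y31 y41 =>
    let cb5 := (c * y52 * y51 + y33 * y32) / (y52 * y51 + y33 * y32) in
    vec10 [:: cb5 * y52; y33; y22; y42; y32; c / cb5 * y51; y01; y21; y31;
              y41]).

Definition gammabar5_coord (K : fieldType) : aff K 'I_10 -> K :=
  with_coords (fun y52 y33 y22 y42 y32 y51 y01 y21 y31 y41 =>
    y52 ^+ 2 * y51 ^+ 2 / (y33 * y32 * y31)).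

Definition epsilonbar5_coord (K : fieldType) : aff K 'I_10 -> K :=
  with_coords (fun y52 y33 y22 y42 y32 y51 y01 y21 y31 y41 =>
    1 / y52 * (1 + y33 * y32 / (y52 * y51))).

Definition e0 (K : fieldType) (c : K) : aff K spin -> aff K spin -> Prop :=
  rcomp (rinv (@sigma_bar K))
    (rcomp (chart_map (@V2 K) (@V2 K) (ebar5_coord c)) (@sigma_bar K)).

Definition gamma0 (K : fieldType) : aff K spin -> K -> Prop :=
  rcomp (chart_fun (@V2 K) (@gammabar5_coord K)) (@sigma_bar K).

Definition epsilon0 (K : fieldType) : aff K spin -> K -> Prop :=
  rcomp (chart_fun (@V2 K) (@epsilonbar5_coord K)) (@sigma_bar K).

Definition V1_e (K : fieldType) (k : 'I_6) (c : K) :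
    aff K spin -> aff K spin -> Prop :=
  if val k == 0%N then e0 c else chart_map (@V1 K) (@V1 K) (e_coord k c).

Definition V1_gamma (K : fieldType) (k : 'I_6) : aff K spin -> K -> Prop :=
  if val k == 0%N then @gamma0 K
  else chart_fun (@V1 K) (@gamma_coord K k).

Definition V1_epsilon (K : fieldType) (k : 'I_6) : aff K spin -> K -> Prop :=
  if val k == 0%N then @epsilon0 K
  else chart_fun (@V1 K) (@epsilon_coord K k).

Definition gamma0_coord (K : fieldType) : aff K 'I_10 -> K :=
  with_coords (fun x42 x33 x22 x52 x32 x41 x11 x21 x31 x51 =>
    1 / (x22 * x21)).

Definition epsilon0_coord (K : fieldType) (x : aff K 'I_10) : K :=
  with_coords (fun x42 x33 x22 x52 x32 x41 x11 x21 x31 x51 =>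
    x51 + A_coord x) x.

Definition e0_coord (K : fieldType) (c : K) (x : aff K 'I_10) : aff K 'I_10 :=
  let A := A_coord x in let B := B_coord x in let C := C_coord x in
  with_coords (fun x42 x33 x22 x52 x32 x41 x11 x21 x31 x51 =>
    let x42' := x42 * ((c * (x51 + B + x22 * x41 * x21 / (x33 * x32))
                        + x22 * x21 / x42) / (c * (x51 + A))) in
    let x33' := x33 * ((c * (x51 + x32 * x31 / x52) + x22 * x31 / x33 + C)
                       / (c * (x51 + A))) in
    let x22' := x22 / c in
    let x52' := x52 * ((c * x51 + A) / (c * (x51 + A))) in
    let x32' := x32 * ((c * (x51 + B) + C)
                       / (c * (c * (x51 + x32 * x31 / x52)
                               + x22 * x31 / x33 + C))) in
    let x41' := x41 * ((x51 + A)
                       / (c * (x51 + B + x22 * x41 * x21 / (x33 * x32))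
                          + x22 * x21 / x42)) in
    let x11' := x11 / c in
    let x21' := x21 / c in
    let x31' := x31 * ((x51 + A) / (c * (x51 + B) + C)) in
    let x51' := x51 * ((x51 + A) / (c * x51 + A)) in
    vec10 [:: x42'; x33'; x22'; x52'; x32'; x41'; x11'; x21'; x31'; x51']) x.

(* Main.v *)
(* The idea is to read [e_k^c] on vectors instead of coordinates. In the spin
   module the transposes [e_k] of the [f_k] satisfy [e_k^2 = 0] and
   [e_i e_j e_i = 0] for adjacent [i, j], and one finds
     [e_k^c (v) = l (v + (c - 1) / eps_k (v) * e_k v)],
   with [l = 1] for [k > 0] and [l = 1/c] for [k = 0] (the scalar restoring the
   normalisation that the lowest coordinate of [V1 x] is 1). As [sigma_bar] is,
   up to a scalar, a permutation of the coordinates of the module, the case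
   [k = 0] follows from the formula for [e_4] and this also yields the explicit
   formulas. Write [eps_k = Q_k / P_k] with [Q_k = e_k P_k] for suitable minors
   and [rho_ij = (e_i Q_j) / P_j] for adjacent [i, j]. Then [rho_ij] is invariant
   under [e_i^c], is divided by [c] under [e_j^c], and
     [rho_ij + rho_ji = eps_i eps_j],
   so the Verma relations reduce to the identity
     [exp (a e_i) exp (b e_j) exp (d e_i)
        = exp (d' e_j) exp (s e_i) exp (a' e_j)],
   where [s = a + d], [a' + d' = b], [s a' = a b] and [d' s = b d]. Finally [V1]
   is an isomorphism from the torus onto a locally closed set, the inverse being
   triangular, which reduces everything about rational maps to the torus. *)
Require Import Defs.
From HB Require Import structures.
From mathcomp Require Import all_boot all_order all_algebra.
From mathcomp Require Import mpoly complex.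
From mathcomp Require Import classical_sets reals.
From mathcomp Require Import boolp ring.
Import Order.TTheory GRing.Theory Num.Theory.
Local Open Scope classical_set_scope.
Local Open Scope ring_scope.

Set Implicit Arguments.
Unset Strict Implicit.
Unset Printing Implicit Defensive.

(** * Regular functions and principal open sets *)

Section RegularFunctions.
Variable K : fieldType.
Implicit Types J : finType.

(** The maps in the statement are partial relations compared on open dense sets, so each identity of
    composites also needs generic points at which all composites are defined. This needs [e_k^c] to
    be dominant, which is obtained from [e_k^(c^-1)]: it gives a preimage of a generic point. For
    this one must know that [ec k c x] lies in the torus as soon as its candidate vector is some
    [V1 y]; that is [ec_torus], and it is also what lets [sigma_bar] be crossed in both directions.
    The coordinate formulas are never composed. Each is compared once with the sixteen entries of
    [V1]; afterwards only vectors are handled, up to a scalar that the lowest entry fixes. The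
    quantities [rho_ij] are there because [eps_j] changes under [e_i^c] for adjacent [i], [j] by no
    simple factor; each summand of [eps_i eps_j] does, so the new [eps_j] is recovered from the sum.
    Finally, for a fixed complex [c] no positivity argument shows that a domain is nonempty; a point
    with one coordinate huge compared with [c] (or the inverse of such a number) is used. *)

Lemma pevalE J (p : {mpoly K[#|J|]}) v :
  peval p v =
  \sum_(m <- msupp p) p@_m * \prod_i v (enum_val i) ^+ m i.
Proof. by rewrite /peval mevalE. Qed.

Lemma pevalD J (p q : {mpoly K[#|J|]}) v :
  peval (p + q) v = peval p v + peval q v.
Proof. exact: mevalD. Qed.

Lemma pevalN J (p : {mpoly K[#|J|]}) v : peval (- p) v = - peval p v.
Proof. exact: mevalN. Qed.

Lemma pevalM J (p q : {mpoly K[#|J|]}) v :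
  peval (p * q) v = peval p v * peval q v.
Proof. exact: mevalM. Qed.

Lemma pevalC J c v : @peval K J c%:MP v = c.
Proof. exact: mevalC. Qed.

Lemma peval1 J v : @peval K J 1 v = 1.
Proof. exact: meval1. Qed.

Definition pvar J (j : J) : {mpoly K[#|J|]} := 'X_(enum_rank j).

Lemma peval_var J (j : J) v : peval (pvar j) v = v j.
Proof. by rewrite /peval mevalXU enum_rankK. Qed.

(** A single fraction has to serve on all of [D]. This is stronger than being locally a fraction,
    but sums, products and composites then need no gluing. *)
Definition ratfun J (D : aff K J -> Prop) (f : aff K J -> K) : Prop :=
  exists n d : {mpoly K[#|J|]},
    forall x, D x -> peval d x != 0 /\ f x = peval n x / peval d x.

Definition ratmap J J' (D : aff K J -> Prop) (f : aff K J -> aff K J') : Prop :=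
  forall j, ratfun D (fun x => f x j).

(** Principal open sets only: that two nonempty ones in the torus meet is then a statement about a
    product of two polynomials. *)
Definition popen J (D P : aff K J -> Prop) : Prop :=
  exists p : {mpoly K[#|J|]}, forall x, D x -> P x <-> peval p x != 0.

Section Closure.
Variables (J : finType) (D : aff K J -> Prop).
Implicit Types f g : aff K J -> K.

Lemma ratfun_peval (p : {mpoly K[#|J|]}) : ratfun D (peval p).
Proof. by exists p, 1 => x _; rewrite peval1 oner_neq0 divr1. Qed.

Lemma ratfun_cst c : ratfun D (fun=> c).
Proof. by exists c%:MP, 1 => x _; rewrite peval1 pevalC oner_neq0 divr1. Qed.

Lemma ratfun_var j : ratfun D (fun x => x j).
Proof. by exists (pvar j), 1 => x _; rewrite peval1 peval_var oner_neq0 divr1. Qed.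

Lemma ratfunD f g : ratfun D f -> ratfun D g -> ratfun D (fun x => f x + g x).
Proof.
move=> [n [d h]] [n' [d' h']]; exists (n * d' + n' * d), (d * d') => x Dx.
have [d0 ->] := h _ Dx; have [d'0 ->] := h' _ Dx.
by rewrite pevalD !pevalM mulf_neq0 // addf_div.
Qed.

Lemma ratfunN f : ratfun D f -> ratfun D (fun x => - f x).
Proof.
move=> [n [d h]]; exists (- n), d => x Dx.
by have [d0 ->] := h _ Dx; rewrite pevalN mulNr.
Qed.

Lemma ratfunM f g : ratfun D f -> ratfun D g -> ratfun D (fun x => f x * g x).
Proof.
move=> [n [d h]] [n' [d' h']]; exists (n * n'), (d * d') => x Dx.
have [d0 ->] := h _ Dx; have [d'0 ->] := h' _ Dx.
by rewrite !pevalM mulf_neq0 // mulf_div.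
Qed.

Lemma ratfunV f : (forall x, D x -> f x != 0) -> ratfun D f ->
  ratfun D (fun x => (f x)^-1).
Proof.
move=> f0 [n [d h]]; exists d, n => x Dx; have := f0 _ Dx.
have [d0 ->] := h _ Dx; rewrite mulf_eq0 negb_or => /andP[-> _].
by rewrite invf_div.
Qed.

Lemma ratfunX f n : ratfun D f -> ratfun D (fun x => f x ^+ n).
Proof.
move=> rf; elim: n => [|n IH].
  by under eq_fun do rewrite expr0; exact: ratfun_cst.
by under eq_fun do rewrite exprS; exact: ratfunM.
Qed.

Lemma ratfun_sum (I : Type) (r : seq I) (F : I -> aff K J -> K) :
  (forall i, ratfun D (F i)) -> ratfun D (fun x => \sum_(i <- r) F i x).
Proof.
move=> rF; elim: r => [|i r IH].
  by under eq_fun do rewrite big_nil; exact: ratfun_cst.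
by under eq_fun do rewrite big_cons; exact: ratfunD.
Qed.

Lemma ratfun_prod (I : Type) (r : seq I) (F : I -> aff K J -> K) :
  (forall i, ratfun D (F i)) -> ratfun D (fun x => \prod_(i <- r) F i x).
Proof.
move=> rF; elim: r => [|i r IH].
  by under eq_fun do rewrite big_nil; exact: ratfun_cst.
by under eq_fun do rewrite big_cons; exact: ratfunM.
Qed.

Lemma eq_ratfun f g : (forall x, D x -> f x = g x) -> ratfun D f -> ratfun D g.
Proof. by move=> e [n [d h]]; exists n, d => x Dx; rewrite -e //; exact: h. Qed.

Lemma popen_neq0 f : ratfun D f -> popen D (fun x => f x != 0).
Proof.
move=> [n [d h]]; exists n => x Dx; have [d0 ->] := h _ Dx.
by rewrite mulf_eq0 invr_eq0 (negPf d0) orbF.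
Qed.

Lemma popenT : popen D (fun=> True).
Proof. by exists 1 => x _; rewrite peval1 oner_neq0. Qed.

Lemma eq_popen P Q : (forall x, D x -> P x <-> Q x) -> popen D P -> popen D Q.
Proof. by move=> e [p h]; exists p => x Dx; rewrite -e //; exact: h. Qed.

Lemma popenI P Q : popen D P -> popen D Q -> popen D (fun x => P x /\ Q x).
Proof.
move=> [p hp] [q hq]; exists (p * q) => x Dx.
rewrite pevalM mulf_eq0 negb_or; split => [[/hp-> // /hq-> //]|].
by move=> /andP[/hp Px /hq Qx]; split; [exact: Px | exact: Qx].
Qed.

Lemma popenI3 P Q R : popen D P -> popen D Q -> popen D R ->
  popen D (fun x => [/\ P x, Q x & R x]).
Proof.
move=> hP hQ hR; apply: eq_popen (popenI hP (popenI hQ hR)) => x _.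
by split=> [[? []]|[]].
Qed.

Lemma popenI4 P Q R S : popen D P -> popen D Q -> popen D R -> popen D S ->
  popen D (fun x => [/\ P x, Q x, R x & S x]).
Proof.
move=> hP hQ hR hS; apply: eq_popen (popenI hP (popenI3 hQ hR hS)) => x _.
by split=> [[? []]|[]].
Qed.

Lemma popenI5 P Q R S T : popen D P -> popen D Q -> popen D R -> popen D S ->
  popen D T -> popen D (fun x => [/\ P x, Q x, R x, S x & T x]).
Proof.
move=> hP hQ hR hS hT; apply: eq_popen (popenI hP (popenI4 hQ hR hS hT)) => x _.
by split=> [[? []]|[]].
Qed.

(* The second set only needs to be open in the first one. *)
Lemma popenI_dep P Q : popen D P -> popen (fun x => D x /\ P x) Q ->
  popen D (fun x => P x /\ Q x).
Proof.
move=> [p hp] [q hq]; exists (p * q) => x Dx.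
rewrite pevalM mulf_eq0 negb_or; split.
  by move=> [Px Qx]; rewrite (hp x Dx).1 //= (hq x _).1.
by move=> /andP[/hp Px qx]; have := Px Dx => {}Px; split=> //; apply/(hq x).
Qed.

Lemma popen_all (I : finType) (P : I -> aff K J -> Prop) :
  (forall i, popen D (P i)) -> popen D (fun x => forall i, P i x).
Proof.
move=> /fin_all_exists[p hp]; exists (\prod_i p i) => x Dx.
have -> : peval (\prod_i p i) x = \prod_i peval (p i) x.
  by rewrite /peval (big_morph _ (mevalM _) (meval1 _)).
rewrite prodf_seq_neq0; split=> [h|/allP h i].
  by apply/allP => i _; apply/hp.
by apply/hp => //; exact: h (mem_index_enum i).
Qed.

End Closure.

Lemma sub_ratfun J (D D' : aff K J -> Prop) f :
  (forall x, D' x -> D x) -> ratfun D f -> ratfun D' f.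
Proof. by move=> s [n [d h]]; exists n, d => x /s /h. Qed.

Section Composition.
Variables (J J' : finType) (D : aff K J -> Prop) (D' : aff K J' -> Prop).
Variable g : aff K J -> aff K J'.
Hypotheses (rg : ratmap D g) (Dg : forall x, D x -> D' (g x)).

Lemma ratfun_peval_comp (p : {mpoly K[#|J'|]}) :
  ratfun D (fun x => peval p (g x)).
Proof.
under eq_fun do rewrite pevalE.
apply: ratfun_sum => m; apply: ratfunM; first exact: ratfun_cst.
by apply: ratfun_prod => i; apply: ratfunX; exact: rg.
Qed.

Lemma ratfun_comp f : ratfun D' f -> ratfun D (fun x => f (g x)).
Proof.
move=> [n [d h]].
apply: (@eq_ratfun _ _ (fun x => peval n (g x) * (peval d (g x))^-1)).
  by move=> x /Dg /h[].
apply: ratfunM; first exact: ratfun_peval_comp.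
by apply: ratfunV; [move=> x /Dg /h[] | exact: ratfun_peval_comp].
Qed.

Lemma popen_comp P : popen D' P -> popen D (fun x => P (g x)).
Proof.
move=> [p h]; apply: (@eq_popen _ _ (fun x => peval p (g x) != 0)).
  by move=> x Dx; rewrite h //; exact: Dg.
by apply: popen_neq0; exact: ratfun_peval_comp.
Qed.

End Composition.

End RegularFunctions.

(** * Generic points and charts *)

Section Generic.
Variable K : numFieldType.
Implicit Types J : finType.

Lemma peval_line J (p : {mpoly K[#|J|]}) (v w : aff K J) :
  exists q : {poly K}, forall t,
    q.[t] = peval p [ffun j => v j + t * (w j - v j)].
Proof.
exists (\sum_(m <- msupp p) p@_m *:
  \prod_i ((v (enum_val i))%:P + (w (enum_val i) - v (enum_val i)) *: 'X)
    ^+ m i) => t.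
rewrite pevalE horner_sum; apply: eq_bigr => m _.
rewrite hornerZ horner_prod; congr (_ * _); apply: eq_bigr => i _.
by rewrite horner_exp hornerD hornerC hornerZ hornerX ffunE [t * _]mulrC.
Qed.

(** In characteristic zero the integers below [size q] are pairwise distinct, and they are one more
    than the degree of [q] allows as roots. *)
Lemma poly_nonroot (q : {poly K}) : q != 0 -> exists t, q.[t] != 0.
Proof.
move=> q0; apply: contrapT => /forallNP h.
have inj : injective (fun i : 'I_(size q) => i%:R : K).
  by move=> i j /eqP; rewrite eqr_nat => /eqP /val_inj.
have := @max_poly_roots K q [seq i%:R | i : 'I_(size q)] q0.
rewrite size_map size_enum_ord ltnn map_inj_uniq ?enum_uniq // => H.
suff: false by []; apply: H => //.
by apply/allP => _ /mapP[i _ ->]; apply: contrapT => /negP; exact: h.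
Qed.

(* Any two nonzero polynomials have a common non-root: look for it on the    *)
(* line through a non-root of each.                                          *)
Lemma torus_common_nonroot J (p q : {mpoly K[#|J|]}) (x y : aff K J) :
  torus K J x -> peval p x != 0 -> peval q y != 0 ->
  exists z, [/\ torus K J z, peval p z != 0 & peval q z != 0].
Proof.
move=> Tx px qy.
(* With all coordinates multiplied into [p], a non-root of [r] lies in the torus. On the line,
   parameter 0 is [x] and parameter 1 is [y]. *)
pose r := p * \prod_j pvar K j.
have rE z : peval r z = peval p z * \prod_j z j.
  rewrite pevalM; congr (_ * _).
  rewrite /peval (big_morph _ (mevalM _) (meval1 _)); apply: eq_bigr => j _.
  exact: peval_var.
have [r1 hr] := peval_line r x y; have [q1 hq] := peval_line q x y.
have [|t] := @poly_nonroot (r1 * q1).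
  rewrite mulf_neq0 //.
    apply/eqP => r0; have := hr 0; rewrite r0 horner0 => /esym/eqP.
    have -> : [ffun j => x j + 0 * (y j - x j)] = x.
      by apply/ffunP => j; rewrite ffunE mul0r addr0.
    rewrite rE mulf_eq0 (negPf px) prodf_seq_eq0 => /hasP[j _ /=].
    by rewrite (negPf (Tx j)).
  apply/eqP => q0; have := hq 1; rewrite q0 horner0 => /esym/eqP.
  have -> : [ffun j => x j + 1 * (y j - x j)] = y.
    by apply/ffunP => j; rewrite ffunE mul1r addrC subrK.
  by rewrite (negPf qy).
rewrite hornerM mulf_eq0 negb_or hr hq rE mulf_eq0 negb_or => /andP[/andP[pz]].
rewrite prodf_seq_neq0 => /allP Tz qz; eexists; split; [|exact: pz|exact: qz].
by move=> j; exact: Tz (mem_index_enum j).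
Qed.

(** The auxiliary open set [Q] makes the notion monotone in [P], so that [P] may be any relation,
    not necessarily an open condition. *)
Definition generic J (P : aff K J -> Prop) : Prop :=
  exists2 Q, popen (torus K J) Q &
    (exists2 x, torus K J x & Q x) /\ (forall x, torus K J x -> Q x -> P x).

Lemma popen_generic J (P : aff K J -> Prop) x :
  popen (torus K J) P -> torus K J x -> P x -> generic P.
Proof. by move=> oP Tx Px; exists P => //; split=> //; exists x. Qed.

Lemma generic_imp J (P Q : aff K J -> Prop) :
  (forall x, torus K J x -> P x -> Q x) -> generic P -> generic Q.
Proof.
by move=> PQ [P' oP [neP sP]]; exists P' => //; split=> // x Tx /(sP _ Tx); exact: PQ.
Qed.

Lemma genericT J (P : aff K J -> Prop) :
  (forall x, torus K J x -> P x) -> generic P.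
Proof.
move=> h; exists (fun=> True); first exact: popenT.
by split=> [|x Tx _]; [exists [ffun=> 1] => // j; rewrite ffunE oner_neq0 | exact: h].
Qed.

Lemma genericI J (P Q : aff K J -> Prop) :
  generic P -> generic Q -> generic (fun x => P x /\ Q x).
Proof.
move=> [P' oP [[x Tx Px] sP]] [Q' oQ [[y Ty Qy] sQ]].
exists (fun x => P' x /\ Q' x); first exact: popenI.
split; last by move=> z Tz [/(sP _ Tz) ? /(sQ _ Tz) ?].
case: oP oQ => p hp [q hq].
have [z [Tz /hp Pz /hq Qz]] :=
  torus_common_nonroot Tx ((hp _ Tx).1 Px) ((hq _ Ty).1 Qy).
by exists z => //; split; [exact: Pz | exact: Qz].
Qed.

Lemma generic_ex J (P : aff K J -> Prop) :
  generic P -> exists2 x, torus K J x & P x.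
Proof. by move=> [Q _ [[x Tx Qx] s]]; exists x => //; exact: s. Qed.

(* Pull-back of genericity along a dominant rational map [f] with domain     *)
(* [D]; its dominance is expressed by the last hypothesis.                   *)
Lemma generic_comp J J' (D : aff K J -> Prop) (f : aff K J -> aff K J')
    (P : aff K J' -> Prop) :
  popen (torus K J) D ->
  ratmap (fun x => torus K J x /\ D x) f ->
  (forall x, torus K J x -> D x -> torus K J' (f x)) ->
  generic (fun y => exists x, [/\ torus K J x, D x & f x = y]) ->
  generic P -> generic (fun x => D x /\ P (f x)).
Proof.
move=> oD rf Tf df gP.
have [Q oQ [neQ sQ]] := gP.
(* The pulled-back set is open in any case; dominance serves to find one point of it, above a point
   of [Q] that lies in the image. *)
have [y Ty [[x [Tx Dx fx]] Qy]] :
  exists2 y, torus K J' y & (exists x, [/\ torus K J x, D x & f x = y]) /\ Q y.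
  apply: generic_ex; apply: genericI => //.
  by case: neQ => y Ty Qy; exact: popen_generic Ty Qy.
exists (fun x => D x /\ Q (f x)).
  apply: popenI_dep => //.
  by apply: (popen_comp rf _ oQ) => z [Tz Dz]; exact: Tf.
split; first by exists x => //; rewrite fx.
by move=> z Tz [Dz Qz]; split=> //; apply: sQ => //; exact: Tf.
Qed.

Lemma zopen_nonroot J (p : {mpoly K[#|J|]}) :
  zopen [set v : aff K J | peval p v != 0].
Proof.
exists [set p]; apply/seteqP; split=> v /=.
  by move=> /negP/negPn/eqP h q ->.
by move=> /(_ p erefl) ->; rewrite eqxx.
Qed.

(** Principal open sets form a basis: one of the equations of the complement fails at [v]. *)
Lemma zopen_inside J (O : set (aff K J)) v : zopen O -> O v ->
  exists2 q : {mpoly K[#|J|]}, peval q v != 0 &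
    forall w, peval q w != 0 -> O w.
Proof.
move=> [P hP] Ov.
have [q Pq qv] : exists2 q, P q & peval q v != 0.
  apply: contrapT => h; have : (~` O) v; last by apply.
  rewrite hP => q Pq; apply/eqP; apply: contrapT => /negP qv; apply: h.
  by exists q.
exists q => // w qw; apply: contrapT => nO.
by have : (~` O) w by []; rewrite hP => /(_ q Pq) /eqP; rewrite (negPf qw).
Qed.

Record chart J0 J (X : set (aff K J)) (th : aff K J0 -> aff K J)
    (thi : aff K J -> aff K J0) : Prop := {
  chart_in : forall x, torus K J0 x -> X (th x);
  chart_onto : forall v, X v -> exists2 x, torus K J0 x & v = th x;
  chartK : forall x, torus K J0 x -> thi (th x) = x;
  chart_rat : ratmap (torus K J0) th;
  chart_inv_rat : ratmap X thi
}.

Section Chart.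
Variables (J0 J : finType) (X : set (aff K J)).
Variables (th : aff K J0 -> aff K J) (thi : aff K J -> aff K J0).
Hypothesis C : chart X th thi.

Lemma chart_inv_torus v : X v -> torus K J0 (thi v).
Proof. by move=> /(chart_onto C)[x Tx ->]; rewrite (chartK C). Qed.

Lemma chart_invK v : X v -> th (thi v) = v.
Proof. by move=> /(chart_onto C)[x Tx ->]; rewrite (chartK C). Qed.

Lemma chart_zopen P : popen (torus K J0) P ->
  exists2 p : {mpoly K[#|J|]}, True &
    forall v, X v -> P (thi v) <-> peval p v != 0.
Proof.
move=> oP; have [p hp] := popen_comp (chart_inv_rat C) chart_inv_torus oP.
by exists p.
Qed.

(** Openness is pulled back along [thi], density along [th]: an open set meeting [X] becomes a
    nonempty open subset of the torus, and such a set meets [P]. *)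
Lemma chart_open_dense P U : popen (torus K J0) P ->
  (exists2 x, torus K J0 x & P x) ->
  (forall v, U v -> X v) ->
  (forall x, torus K J0 x -> U (th x) <-> P x) ->
  open_dense X U.
Proof.
move=> oP neP UX UP; split.
  have [p _ hp] := chart_zopen oP.
  exists [set v | peval p v != 0]; first exact: zopen_nonroot.
  apply/seteqP; split=> v /=.
    move=> Uv; split; first exact: UX.
    apply/hp; first exact: UX.
    by apply/UP; rewrite ?chart_invK //; [apply: chart_inv_torus|]; exact: UX.
  move=> [Xv /hp h]; rewrite -(chart_invK Xv).
  by apply/UP; [exact: chart_inv_torus | exact: h].
move=> O oO [v [Xv Ov]].
have [q qv sq] := zopen_inside oO Ov.
have [x Tx vE] := chart_onto C Xv.
have oq : popen (torus K J0) (fun x => peval q (th x) != 0).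
  apply: (popen_comp (chart_rat C) (D' := setT) _ (P := fun v => peval q v != 0)) => //.
  by apply: popen_neq0; exact: ratfun_peval.
have [y Ty [Py qy]] : exists2 y, torus K J0 y & P y /\ peval q (th y) != 0.
  apply: generic_ex; apply: genericI.
    by case: neP => y Ty Py; exact: popen_generic Ty Py.
  by apply: popen_generic Tx _ => //=; rewrite -vE.
by exists (th y); split; [apply/UP | exact: sq].
Qed.

Lemma generic_open_dense (P : aff K J0 -> Prop) : generic P ->
  exists2 U, open_dense X U &
    forall v, U v -> exists x, [/\ torus K J0 x, P x & v = th x].
Proof.
move=> [Q oQ [neQ sQ]].
exists [set v | exists x, [/\ torus K J0 x, Q x & v = th x]].
  apply: chart_open_dense oQ neQ _ _ => [v [x [Tx _ ->]]|x Tx].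
    exact: (chart_in C).
  split=> [[y [Ty Qy /(congr1 thi)]]|Qx]; last by exists x.
  by rewrite !(chartK C) // => ->.
by move=> v [x [Tx Qx ->]]; exists x; split=> //; exact: sQ.
Qed.

Lemma chart_ratmap_eq (T : Type) (F G : aff K J -> T -> Prop) :
  generic (fun x => exists w, F (th x) w /\ G (th x) w) -> ratmap_eq X F G.
Proof.
by move=> /generic_open_dense[U oU hU]; exists U => // v /hU[x [_ h ->]].
Qed.

(** On the whole open set given by [P], the composite of [thi] and [h] is one tuple of fractions, so
    the same representative witnesses regularity at every point. *)
Lemma chart_rational_map (J' : finType) (Y : set (aff K J'))
    (F : aff K J -> aff K J' -> Prop) (P : aff K J0 -> Prop)
    (h : aff K J0 -> aff K J') :
  popen (torus K J0) P -> (exists2 x, torus K J0 x & P x) ->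
  ratmap (fun x => torus K J0 x /\ P x) h ->
  (forall x, torus K J0 x -> P x -> Y (h x)) ->
  (forall x w, torus K J0 x -> F (th x) w <-> P x /\ w = h x) ->
  rational_map X Y F.
Proof.
move=> oP neP rh Yh FE; split.
- apply: (chart_open_dense oP neP) => [v []//|x Tx].
  split=> [[_ [w /FE-/(_ Tx)[]//]]|Px]; split; first exact: (chart_in C).
  by exists (h x); apply/FE.
- move=> v w w' /(chart_onto C)[x Tx ->].
  by move=> /FE-/(_ Tx)[_ ->] /FE-/(_ Tx)[_ ->].
- by move=> v w /(chart_onto C)[x Tx ->] /FE-/(_ Tx)[Px ->]; exact: Yh.
move=> v w Xv Fvw; split=> //.
have [p _ hp] := chart_zopen oP.
have : ratmap (fun v => X v /\ peval p v != 0) (fun v => h (thi v)).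
  move=> j; apply: (@ratfun_comp _ _ _ _ _ thi _ _ (fun x => h x j) (rh j)).
    by move=> i; apply: sub_ratfun (chart_inv_rat C i) => u [].
  by move=> u [Xu /(hp _ Xu) ?]; split=> //; exact: chart_inv_torus.
move=> /fin_all_exists[num /fin_all_exists[den nd]].
exists [set v | peval p v != 0], num, den; split.
- exact: zopen_nonroot.
- apply/hp => //; have [x Tx vE] := chart_onto C Xv.
  by move: Fvw; rewrite vE (chartK C) // => /FE-/(_ Tx)[].
move=> u Xu /= pu.
have E : rat_eval num den u = h (thi u).
  by apply/ffunP => j; rewrite ffunE; have [] := nd j u (conj Xu pu).
have Tu := chart_inv_torus Xu; have Pu := (hp u Xu).2 pu.
rewrite E; split.
- by move=> j; have [] := nd j u (conj Xu pu).
- exact: Yh.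
by move=> w'; rewrite -{1}(chart_invK Xu) => /FE-/(_ Tu)[].
Qed.

(** If [X] lies in neither closed set, then for each of them one of its equations is generically
    nonzero on the torus; both are then nonzero at a common point, which lies in neither set. *)
Lemma chart_irreducible_variety :
  (exists O Z, [/\ zopen O, zclosed Z & X = O `&` Z]) ->
  irreducible_variety X.
Proof.
move=> lc; split=> //.
  exists (th [ffun=> 1]); apply: (chart_in C) => j.
  by rewrite ffunE oner_neq0.
move=> Z1 Z2 [P1 E1] [P2 E2] XZ; apply: contrapT => /not_orP[n1 n2].
have escape (Z : set (aff K J)) P :
    Z = [set v | forall p, P p -> peval p v = 0] -> ~ (X `<=` Z) ->
    exists2 p, P p & generic (fun x => peval p (th x) != 0).
  move=> ZE /existsNP[v /not_implyP[Xv]]; rewrite ZE => /existsNP[p].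
  move=> /not_implyP[Pp /eqP pv]; exists p => //.
  have [x Tx vE] := chart_onto C Xv.
  apply: popen_generic Tx _; last by rewrite -vE.
  apply: (popen_comp (chart_rat C) (D' := setT) _ (P := fun v => peval p v != 0)) => //.
  by apply: popen_neq0; exact: ratfun_peval.
have [p Pp gp] := escape _ _ E1 n1; have [q Qq gq] := escape _ _ E2 n2.
have [x Tx [px qx]] := generic_ex (genericI gp gq).
have [] := XZ _ (chart_in C Tx); rewrite ?E1 ?E2.
  by move=> /(_ p Pp)/eqP; rewrite (negPf px).
by move=> /(_ q Qq)/eqP; rewrite (negPf qx).
Qed.

End Chart.

End Generic.

Section MoreCharts.
Variable K : numFieldType.
Implicit Types J : finType.

Lemma chart_id J : chart (torus K J) (fun x => x) (fun x => x).
Proof.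
by split=> // [v Tv|j|j]; [exists v | exact: ratfun_var | exact: ratfun_var].
Qed.

(** The image is cut out of the open set [D] by the equations [th (thi v) = v], which become
    polynomial after clearing the denominators [den j]. *)
Lemma locally_closed_chart J0 J (th : aff K J0 -> aff K J)
    (thi : aff K J -> aff K J0) (D : aff K J -> Prop) :
  ratmap (torus K J0) th -> popen setT D -> ratmap D thi ->
  (forall v, D v -> torus K J0 (thi v)) ->
  (forall x, torus K J0 x -> D (th x) /\ thi (th x) = x) ->
  chart (th @` torus K J0) th thi /\ irreducible_variety (th @` torus K J0).
Proof.
move=> rth oD rthi DT thD.
have C : chart (th @` torus K J0) th thi.
  split=> //.
  - by move=> v [x Tx <-]; exists x.
  - by move=> x /thD[].
  move=> j; apply: sub_ratfun (rthi j) => _ [x Tx <-].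
  by have [] := thD _ Tx.
split=> //; apply: (chart_irreducible_variety C).
have : ratmap D (fun v => th (thi v)).
  by move=> j; exact: (ratfun_comp rthi DT (rth j)).
move=> /fin_all_exists[num /fin_all_exists[den nd]].
have [p hp] := oD.
exists [set v | peval p v != 0].
exists [set v | forall j, peval (num j - pvar K j * den j) v = 0]; split.
- exact: zopen_nonroot.
- exists [set q | exists j, q = num j - pvar K j * den j].
  apply/seteqP; split=> v /= h; first by move=> _ [j ->].
  by move=> j; apply: h; exists j.
apply/seteqP; split=> v /=.
  move=> [x Tx <-]; have [Dx xK] := thD _ Tx; split; first exact/hp.
  move=> j; have [dj] := nd j _ Dx; rewrite xK pevalD pevalN pevalM peval_var => ->.
  by rewrite divfK // subrr.
move=> [/hp-/(_ I) Dv e]; exists (thi v); first exact: DT.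
apply/ffunP => j; have [dj ->] := nd j _ Dv.
have /eqP := e j; rewrite pevalD pevalN pevalM peval_var subr_eq0 => /eqP ->.
by rewrite mulfK.
Qed.

Definition ochart J J' (th : aff K J -> aff K J') (u : aff K (option J)) :
  aff K (option J') := apair (gm_part u) (th (aff_part u)).

Lemma gm_part_pair J c (v : aff K J) : gm_part (apair c v) = c.
Proof. by rewrite /gm_part ffunE. Qed.

Lemma aff_part_pair J c (v : aff K J) : aff_part (apair c v) = v.
Proof. by apply/ffunP => j; rewrite !ffunE. Qed.

Lemma apair_parts J (u : aff K (option J)) : apair (gm_part u) (aff_part u) = u.
Proof. by apply/ffunP => -[j|]; rewrite !ffunE. Qed.

Lemma torus_optionE J (u : aff K (option J)) :
  torus K (option J) u <-> gm_part u != 0 /\ torus K J (aff_part u).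
Proof.
split=> [Tu|[c0 Tx] [j|]].
- by split=> [|j]; [exact: Tu | rewrite ffunE; exact: Tu].
- by have := Tx j; rewrite ffunE.
exact: c0.
Qed.

Lemma Gm_times_torus J : Gm_times (torus K J) = torus K (option J).
Proof. by apply/seteqP; split=> u /torus_optionE. Qed.

Lemma ratmap_aff_part J D : ratmap D (@aff_part K J).
Proof.
by move=> j; apply: eq_ratfun (ratfun_var _ (Some j)) => u _; rewrite ffunE.
Qed.

Lemma ochart_chart J0 J (X : set (aff K J)) th thi :
  chart X th thi ->
  @chart K (option J0) (option J) (Gm_times X) (ochart th) (ochart thi).
Proof.
move=> C; split.
- move=> u /torus_optionE[c0 Tx]; split; rewrite /ochart ?gm_part_pair //.
  by rewrite aff_part_pair; exact: (chart_in C).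
- move=> u [c0 /(chart_onto C)[x Tx e]]; exists (apair (gm_part u) x).
    by apply/torus_optionE; rewrite gm_part_pair aff_part_pair.
  by rewrite /ochart gm_part_pair aff_part_pair -e apair_parts.
- move=> u /torus_optionE[c0 Tx].
  by rewrite /ochart gm_part_pair aff_part_pair (chartK C) // apair_parts.
- move=> [j|].
    apply: (@eq_ratfun _ _ _ (fun u => th (aff_part u) j)).
      by move=> u _; rewrite !ffunE.
    apply: (ratfun_comp (@ratmap_aff_part _ _) _ (chart_rat C j)).
    by move=> u /torus_optionE[].
  by apply: eq_ratfun (ratfun_var _ None) => u _; rewrite !ffunE.
move=> [j|].
  apply: (@eq_ratfun _ _ _ (fun u => thi (aff_part u) j)).
    by move=> u _; rewrite !ffunE.
  by apply: (ratfun_comp (@ratmap_aff_part _ _) _ (chart_inv_rat C j)) => u [].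
by apply: eq_ratfun (ratfun_var _ None) => u _; rewrite !ffunE.
Qed.

(* The domain of a rational map on [Gm * X] meets [{1} * X] in an open set;  *)
(* hence this set is dense as soon as it contains a generic point.           *)
Lemma ratdom_slice_open_dense J0 J J' (X : set (aff K J)) th thi
    (Z : set (aff K J')) (F : aff K (option J) -> aff K J' -> Prop)
    (P : aff K J0 -> Prop) :
  chart X th thi -> generic P ->
  (forall x, torus K J0 x -> P x -> ratdom (Gm_times X) Z F (apair 1 (th x))) ->
  open_dense X [set v | ratdom (Gm_times X) Z F (apair 1 v)].
Proof.
move=> C gP PD.
have [U [_ dU] hU] := generic_open_dense C gP.
split; last first.
  move=> O oO /(dU O oO)[v [/hU[x [Tx Px ->]] Ov]].
  by exists (th x); split=> //; exact: PD.
(* Substituting 1 for the variable of index [None] makes the slice of a closed set closed. *)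
have restr (p : {mpoly K[#|{: option J}|]}) :
    exists q : {mpoly K[#|J|]}, forall v, peval q v = peval p (apair 1 v).
  exists (\sum_(m <- msupp p) p@_m *:
    \prod_i (if enum_val i is Some j then pvar K j else 1) ^+ m i) => v.
  rewrite [RHS]pevalE /peval raddf_sum; apply: eq_bigr => m _ /=.
  rewrite mevalZ (big_morph _ (mevalM _) (meval1 _)); congr (_ * _).
  apply: eq_bigr => i _; rewrite rmorphXn /= ffunE; congr (_ ^+ _).
  by case: (enum_val i) => [j|]; [exact: peval_var | exact: meval1].
(* Different points of the domain may need different fractions, so the slice is described as the
   union over all open sets carrying some representative. *)
pose good (O : set (aff K (option J))) :=
  exists num den, forall u, Gm_times X u -> O u ->
   [/\ forall j : J', peval (den j) u != 0, Z (rat_eval num den u)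
    & forall w, F u w -> w = rat_eval num den u].
exists [set v | exists O, [/\ zopen O, good O & O (apair 1 v)]].
  exists [set q | exists O p, [/\ zopen O, good O,
    forall u, peval p u != 0 -> O u & forall v, peval q v = peval p (apair 1 v)]].
  apply/seteqP; split=> v /=.
    move=> nO q [O [p [oO gO pO qE]]]; apply/eqP; apply: contrapT => /negP qv.
    by apply: nO; exists O; split=> //; apply: pO; rewrite -qE.
  move=> h [O [oO gO Ov]].
  have [p pv pO] := zopen_inside oO Ov; have [q qE] := restr p.
  have : peval q v = 0 by apply: h; exists O, p.
  by rewrite qE => /eqP; rewrite (negPf pv).
apply/seteqP; split=> v /=.
  move=> [[_ Xv] [O [num [den [oO Ov g]]]]]; rewrite aff_part_pair in Xv.
  by split=> //; exists O; split=> //; exists num, den.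
move=> [Xv [O [oO [num [den g]] Ov]]]; split.
  by split; rewrite ?gm_part_pair ?oner_neq0 // aff_part_pair.
by exists O, num, den.
Qed.

End MoreCharts.

(** * The spin representation *)

(** The partial inverse of [fmove]: it reduces the sum in [f_op] to at most one entry and the
    existential tests in [wt] to a computation. *)
Definition fback (k : nat) (s : signs) : option signs :=
  match k, s with
  | 0, (true, true, i3, i4, i5) => Some (false, false, i3, i4, i5)
  | 1, (false, true, i3, i4, i5) => Some (true, false, i3, i4, i5)
  | 2, (i1, false, true, i4, i5) => Some (i1, true, false, i4, i5)
  | 3, (i1, i2, false, true, i5) => Some (i1, i2, true, false, i5)
  | 4, (i1, i2, i3, false, true) => Some (i1, i2, i3, true, false)
  | 5, (i1, i2, i3, false, false) => Some (i1, i2, i3, true, true)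
  | _, _ => None
  end.

Lemma fmove_back k s t : (fmove k s == Some t) = (fback k t == Some s).
Proof.
apply/eqP/eqP; case: k => [|[|[|[|[|[|k]]]]]] //.
1-6: by move: s => [[[[[] []] []] []] []] //= [<-].
all: by move: t => [[[[[] []] []] []] []] //= [<-].
Qed.

Lemma sign_prod_fmove k s t : fmove k s = Some t -> sign_prod t = sign_prod s.
Proof.
case: k => [|[|[|[|[|[|k]]]]]];
  by move: s t => [[[[[] []] []] []] []] t //= [<-].
Qed.

Lemma sign_prod_fback k s t : fback k s = Some t -> sign_prod t = sign_prod s.
Proof. by move=> /eqP; rewrite -fmove_back => /eqP /sign_prod_fmove ->. Qed.

Section SpinVectors.
Variable K : fieldType.
Implicit Types v : aff K spin.

(* The entry of [v] at [s], and 0 at sign vectors of the wrong parity.       *)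
Definition vat v (s : signs) : K := if insub s is Some t then v t else 0.

Lemma vat_val v (t : spin) : vat v (val t) = v t.
Proof. by rewrite /vat valK. Qed.

Lemma vat_inj v w : vat v =1 vat w -> v = w.
Proof. by move=> e; apply/ffunP => t; rewrite -!vat_val e. Qed.

Lemma vat_odd v s : ~~ sign_prod s -> vat v s = 0.
Proof. by move=> h; rewrite /vat insubN. Qed.

Lemma sum_vat_from v k t :
  \sum_(s | farrow k s t) v s = oapp (vat v) 0 (fback k (val t)).
Proof.
case E: (fback k (val t)) => [s|] /=; last first.
  by apply: big1 => s; rewrite /farrow fmove_back E.
have sp : sign_prod s by rewrite (sign_prod_fback E); exact: valP.
rewrite (big_pred1 (Sub s sp)) ?/vat ?insubT // => r.
rewrite /farrow fmove_back E; apply/eqP/eqP => [[e]|-> //].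
by apply: val_inj; exact: esym e.
Qed.

Lemma wtE k s : wt k s =
  if fmove k (val s) then 1 else if fback k (val s) then -1 else 0.
Proof.
rewrite /wt.
have -> : [exists t, farrow k s t] = fmove k (val s) :> bool.
  apply/existsP/idP => [[t]|]; first by rewrite /farrow => /eqP ->.
  case E: (fmove k (val s)) => [t|//] _.
  have tp : sign_prod t by rewrite (sign_prod_fmove E); exact: valP.
  by exists (Sub t tp); rewrite /farrow E.
have -> // : [exists t, farrow k t s] = fback k (val s) :> bool.
apply/existsP/idP => [[t]|]; first by rewrite /farrow fmove_back => /eqP ->.
case E: (fback k (val s)) => [t|//] _.
have tp : sign_prod t by rewrite (sign_prod_fback E); exact: valP.
by exists (Sub t tp); rewrite /farrow fmove_back E.
Qed.

(** The branches correspond to the weights -1, 1 and 0. In the first, [t] has weight 1, and the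
    resulting factor [c] cancels the division by [c] in [Y]. *)
Definition rawY k (c : K) (w : signs -> K) (s : signs) : K :=
  match fback k s with
  | Some t => c^-1 * w s + w t
  | None => if fmove k s then c * w s else w s
  end.

Lemma vatY k c v : c != 0 -> vat (Y k c v) = rawY k c (vat v).
Proof.
move=> c0; apply/funext => s; rewrite /rawY.
have [sp|sp] := boolP (sign_prod s); last first.
  rewrite !vat_odd //; case E: fback => [t|]; last by rewrite mulr0 if_same.
  by rewrite vat_odd ?(sign_prod_fback E) // mulr0 addr0.
rewrite -[s]/(val (Sub s sp : spin)) !vat_val.
move: (Sub s sp) => {}s {sp}.
rewrite ffunE /= !ffunE sum_vat_from wtE.
have := fmove_back k (val s); have := fun t => fmove_back k t (val s).
case Eb: (fback k (val s)) => [t|] /=.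
  move=> /(_ t); rewrite eqxx => /eqP Em.
  case Ef: (fmove k (val s)) => [r|] /=.
    (* No sign vector is both a source and a target of the same [f_k], since [f_k ^ 2 = 0]. *)
    exfalso; move: Eb Ef {Em}; case: (val s) => [[[[]]]].
    by case: k => [|[|[|[|[|[|k]]]]]] [] [] [] [] [].
  move=> _; rewrite /coroot_act.
  have tp : sign_prod t by rewrite (sign_prod_fback Eb); exact: valP.
  rewrite -[t]/(val (Sub t tp : spin)) !vat_val ffunE wtE /= Em /=.
  by rewrite expr1z exprN1 [c * _]mulrC mulfK.
move=> _ _; case: (fmove k (val s)) => [t|] /=; rewrite mul0r addr0.
  by rewrite expr1z.
by rewrite expr0z mul1r.
Qed.

Lemma vat_basis s0 : sign_prod s0 ->
  vat (basis_vec K s0) = fun s => (s == s0)%:R.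
Proof.
move=> sp0; apply/funext => s; rewrite /vat; case: insubP => [t _ <-|nsp].
  by rewrite ffunE.
by case: eqP nsp => // ->; rewrite sp0.
Qed.

End SpinVectors.

Lemma spin_all (P : signs -> Prop) :
  P (true, true, true, true, true) -> P (true, true, true, false, false) ->
  P (true, true, false, true, false) -> P (true, true, false, false, true) ->
  P (true, false, true, true, false) -> P (true, false, true, false, true) ->
  P (true, false, false, true, true) -> P (true, false, false, false, false) ->
  P (false, true, true, true, false) -> P (false, true, true, false, true) ->
  P (false, true, false, true, true) -> P (false, true, false, false, false) ->
  P (false, false, true, true, true) -> P (false, false, true, false, false) ->
  P (false, false, false, true, false) -> P (false, false, false, false, true) ->
  forall s, sign_prod s -> P s.
Proof. by move=> ? ? ? ? ? ? ? ? ? ? ? ? ? ? ? ? [[[[[] []] []] []] []]. Qed.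

(** * The parametrisation [V1] and its triangular inverse *)

Section Coordinates.
Variable K : fieldType.

Lemma with_coords_vec (T : Type) f (a b c d e f' g h i j : K) :
  @with_coords K T f (vec10 [:: a; b; c; d; e; f'; g; h; i; j]) =
  f a b c d e f' g h i j.
Proof. by rewrite /with_coords !ffunE. Qed.

Lemma vec10P (P : aff K 'I_10 -> Prop) :
  (forall a b c d e f g h i j, P (vec10 [:: a; b; c; d; e; f; g; h; i; j])) ->
  forall x, P x.
Proof.
move=> H x.
have -> : x = with_coords (fun a b c d e f g h i j =>
    vec10 [:: a; b; c; d; e; f; g; h; i; j]) x.
  rewrite /with_coords; apply/ffunP => -[k hk]; rewrite !ffunE.
  by do 10![case: k hk => [|k] hk /=; first by congr (x _); apply: val_inj].
exact: H.
Qed.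

Lemma torus_vec10 (s : seq K) : size s = 10%N ->
  torus K 'I_10 (vec10 s) <-> all (fun a => a != 0) s.
Proof.
move=> ss; split=> [Ts|/all_nthP h j].
  by apply/(all_nthP 0) => i; rewrite ss => hi; have := Ts (Ordinal hi); rewrite ffunE.
by rewrite ffunE; apply: h; rewrite ss.
Qed.

Lemma torus_vec10P (a b c d e f g h i j : K) :
  torus K 'I_10 (vec10 [:: a; b; c; d; e; f; g; h; i; j]) <->
  [/\ a != 0, b != 0, c != 0, d != 0 & e != 0] /\
  [/\ f != 0, g != 0, h != 0, i != 0 & j != 0].
Proof.
rewrite torus_vec10 //=; split.
  by move=> /and5P[-> -> -> -> /and5P[-> -> -> -> /and3P[-> ->]]].
by move=> [[-> -> -> -> ->] [-> -> -> -> ->]].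
Qed.

End Coordinates.

Ltac nz := repeat (apply/andP; split);
  first [assumption | exact: isT | exact: oner_neq0].

Section V1.
Variable K : fieldType.

Definition V1_entry (x42 x33 x22 x52 x32 x41 x11 x21 x31 x51 : K) (s : signs) : K :=
  match s with
  | (true, true, true, true, true) => x52 * x51
  | (true, true, true, false, false) => x33 * (x51 + x32 * x31 / x52)
  | (true, true, false, true, false) =>
      x42 * (x51 + x32 * x31 / x52 + x22 * x31 / x33 + x22 * x41 * x21 / (x33 * x32))
  | (true, true, false, false, true) =>
      x51 + x32 * x31 / x52 + x22 * x31 / x33 + x22 * x41 * x21 / (x33 * x32)
      + x22 * x21 / x42
  | (true, false, true, true, false) =>
      x42 * (x31 + x41 * x21 / x32 + x41 * x11 / x22)
  | (true, false, true, false, true) =>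
      x31 + (x41 + x33 * x32 / x42) * (x21 / x32 + x11 / x22)
  | (true, false, false, true, true) => x21 + x32 * x11 / x22 + x52 * x11 / x33
  | (true, false, false, false, false) => x11
  | (false, true, true, true, false) => x42 * x41
  | (false, true, true, false, true) => x41 + x33 * x32 / x42
  | (false, true, false, true, true) => x32 + x22 * x52 / x33
  | (false, true, false, false, false) => x22
  | (false, false, true, true, true) => x52
  | (false, false, true, false, false) => x33
  | (false, false, false, true, false) => x42
  | (false, false, false, false, true) => 1
  | _ => 0
  end.

Lemma V1_at (x : aff K 'I_10) : torus K 'I_10 x ->
  forall s, sign_prod s -> vat (V1 x) s = with_coords V1_entry x s.
Proof.
elim/vec10P: x => x42 x33 x22 x52 x32 x41 x11 x21 x31 x51.
move=> /torus_vec10P[[h42 h33 h22 h52 h32] [h41 h11 h21 h31 h51]].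
rewrite /V1 !with_coords_vec.
do 10![rewrite vatY; last by []].
rewrite vat_basis; last by [].
apply: spin_all; lazy beta iota delta [rawY fback fmove isSome V1_entry].
all: rewrite /=; field; nz.
Qed.

(** Five coordinates are entries of [v]; then [x32] is solved from [f], [x41] from [g], [x21] from
    [k], [x51] from [u], and last [x31] from [l]. Every denominator is itself a coordinate of the
    result, so the result lying in the torus makes all divisions legitimate. *)
Definition V1_inv (v : aff K spin) : aff K 'I_10 :=
  let w := vat v in
  let a := w (false, false, false, true, false) in
  let b := w (false, false, true, false, false) in
  let d := w (false, true, false, false, false) in
  let e := w (false, false, true, true, true) in
  let f := w (false, true, false, true, true) in
  let g := w (false, true, true, false, true) in
  let h := w (true, false, false, false, false) in
  let k := w (true, false, false, true, true) in
  let l := w (true, false, true, false, true) in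
  let u := w (true, true, true, true, true) in
  let x32 := f - d * e / b in
  let x21 := k - h * f / d in
  vec10 [:: a; b; d; e; x32; g - b * x32 / a; h; x21;
            l - g * (x21 / x32 + h / d); u / e].

Lemma V1K x : torus K 'I_10 x -> V1_inv (V1 x) = x.
Proof.
elim/vec10P: x => x42 x33 x22 x52 x32 x41 x11 x21 x31 x51 Tx.
have [[h42 h33 h22 h52 h32] [h41 h11 h21 h31 h51]] :=
  (torus_vec10P _ _ _ _ _ _ _ _ _ _).1 Tx.
rewrite /V1_inv !V1_at // with_coords_vec /V1_entry.
have -> : x32 + x22 * x52 / x33 - x22 * x52 / x33 = x32 by field; nz.
have -> : x21 + x32 * x11 / x22 + x52 * x11 / x33
    - x11 * (x32 + x22 * x52 / x33) / x22 = x21 by field; nz.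
congr (vec10 [:: _; _; _; _; _; _; _; _; _; _]); field; nz.
Qed.

Lemma V1_inj x y : torus K 'I_10 x -> torus K 'I_10 y -> V1 x = V1 y -> x = y.
Proof. by move=> /V1K {2}<- /V1K {2}<- ->. Qed.

Lemma ratfun_vat D s : ratfun D (fun v : aff K spin => vat v s).
Proof.
rewrite /vat; case: insub => [t|]; first exact: ratfun_var.
exact: ratfun_cst.
Qed.

End V1.

Ltac rat := repeat first
  [ exact: ratfun_cst | exact: ratfun_var | exact: ratfun_vat | assumption
  | apply: ratfunD | apply: ratfunN | apply: ratfunX
  | apply: ratfunM | apply: ratfunV ].

Section V1Chart.
Variable K : numFieldType.

Lemma ratmap_vec10 J D (a b c d e f g h i j : aff K J -> K) :
  [/\ ratfun D a, ratfun D b, ratfun D c, ratfun D d & ratfun D e] ->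
  [/\ ratfun D f, ratfun D g, ratfun D h, ratfun D i & ratfun D j] ->
  ratmap D (fun v =>
    vec10 [:: a v; b v; c v; d v; e v; f v; g v; h v; i v; j v]).
Proof.
move=> [ra rb rc rd re] [rf rg rh ri rj] [m hm].
under eq_fun do rewrite ffunE.
by do 10![case: m hm => [|m] hm //=].
Qed.

Lemma ratmap_V1 : ratmap (torus K 'I_10) (@V1 K).
Proof.
move=> s; apply: (@eq_ratfun _ _ _ (fun x => with_coords (@V1_entry K) x (val s))).
  by move=> x Tx; rewrite -V1_at // ?vat_val //; exact: valP.
move: (val s) (valP s); apply: spin_all; rewrite /V1_entry /with_coords; rat.
all: by move=> x Tx; rewrite ?mulf_neq0.
Qed.

(** The ten conditions are regrouped in three stages, so that each denominator is nonzero by an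
    earlier stage: the five coordinates that are entries, then the four with denominators among
    these, then [x31], which also divides by [x32]. *)
Lemma V1_inv_popen : popen setT (fun v => torus K 'I_10 (V1_inv v)).
Proof.
apply: eq_popen.
  move=> v _; apply: iff_sym; rewrite /V1_inv torus_vec10P.
  apply: (iff_trans (B := (_ /\ _ /\ _ /\ _ /\ _) /\
    (_ /\ _ /\ _ /\ _) /\ _)); last exact: iff_refl.
  split=> [[[c0 c1 c2 c3 c4] [c5 c6 c7 c8 c9]]|].
    exact: (conj (conj c0 (conj c1 (conj c2 (conj c3 c6))))
      (conj (conj c4 (conj c5 (conj c7 c9))) c8)).
  by move=> [[c0 [c1 [c2 [c3 c6]]]] [[c4 [c5 [c7 c9]]] c8]].
apply: popenI_dep; first by do !apply: popenI; apply: popen_neq0; rat.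
apply: popenI_dep.
  by do !apply: popenI; apply: popen_neq0; rat => v; tauto.
by apply: popen_neq0; rat => v; tauto.
Qed.

Lemma V1_inv_ratmap :
  ratmap (fun v => torus K 'I_10 (V1_inv v)) (@V1_inv K).
Proof.
apply: ratmap_vec10; split; rat.
all: by move=> v; rewrite /V1_inv /= torus_vec10P => -[[? ? ? ? ?] [? ? ? ? ?]].
Qed.

Lemma V1_chart_irreducible :
  chart (V1_var K) (@V1 K) (@V1_inv K) /\ irreducible_variety (V1_var K).
Proof.
apply: locally_closed_chart (@ratmap_V1) V1_inv_popen V1_inv_ratmap _ _ => // x Tx.
by rewrite V1K.
Qed.

End V1Chart.

(** * The maps [e_k^c] on vectors of the spin module *)

Section SpinAction.
Variable K : fieldType.
Implicit Types (v : aff K spin) (w : signs -> K).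

(* The action of [exp (a e_k)], where [e_k] is the transpose of [f_k]; as    *)
(* [e_k ^ 2 = 0], the exponential is [1 + a e_k].                            *)
Definition raise k (a : K) w (s : signs) : K :=
  w s + a * oapp w 0 (fmove k s).

(** For [k = 0] this is the closed formula of the theorem; its agreement with the definition through
    [sigma_bar] is [e0E]. *)
Definition ec k (c : K) (x : aff K 'I_10) : aff K 'I_10 :=
  if k is 0 then e0_coord c x else e_coord k c x.

Definition eps k (x : aff K 'I_10) : K :=
  if k is 0 then epsilon0_coord x else epsilon_coord k x.

Definition scale_factor k (c : K) : K := if k is 0 then c^-1 else 1.

Lemma V1_scaled_raise k a l x y :
  torus K 'I_10 x -> torus K 'I_10 y ->
  (forall s, sign_prod s -> with_coords (@V1_entry K) y s =
    l * raise k a (with_coords (@V1_entry K) x) s) ->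
  vat (V1 y) = fun s => l * raise k a (vat (V1 x)) s.
Proof.
move=> Tx Ty H; apply/funext => s; rewrite /raise.
have [sp|sp] := boolP (sign_prod s); last first.
  rewrite vat_odd //; case E: fmove => [t|] /=.
    by rewrite !vat_odd ?(sign_prod_fmove E) // mulr0 addr0 mulr0.
  by rewrite vat_odd // mulr0 addr0 mulr0.
rewrite !V1_at // H // /raise; congr (_ * (_ + _ * _)).
case E: fmove => [t|] //=; rewrite V1_at //.
by rewrite (sign_prod_fmove E).
Qed.

Definition ec_cond k (c : K) : aff K 'I_10 -> Prop :=
  with_coords (fun x42 x33 x22 x52 x32 x41 x11 x21 x31 x51 =>
    let B := x22 * x31 / x33 + x32 * x31 / x52 in
    let C := x22 * x21 / x42 + x22 * x41 * x21 / (x33 * x32) in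
    let T1 := x33 * x32 ^+ 2 * x31 in
    let T2 := x22 * x52 * x32 * x31 in
    let T3 := x22 * x52 * x41 * x21 in
    match k with
    | 0 => [/\ x51 + (B + C) != 0,
        c * (x51 + B + x22 * x41 * x21 / (x33 * x32)) + x22 * x21 / x42 != 0,
        c * (x51 + x32 * x31 / x52) + x22 * x31 / x33 + C != 0,
        c * x51 + (B + C) != 0 & c * (x51 + B) + C != 0]
    | 2 => c * x22 * x21 + x32 * x11 != 0 /\ x22 * x21 + x32 * x11 != 0
    | 3 => [/\ c * T1 + T2 + T3 != 0, T1 + T2 + T3 != 0
        & c * T1 + c * T2 + T3 != 0]
    | 4 => c * x42 * x41 + x33 * x32 != 0 /\ x42 * x41 + x33 * x32 != 0
    | 5 => c * x52 * x51 + x32 * x31 != 0 /\ x52 * x51 + x32 * x31 != 0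
    | _ => True
    end).

Lemma mulf_divP (a b d : K) : a / b * d != 0 -> a != 0 /\ b != 0.
Proof. by rewrite !mulf_eq0 invr_eq0 !negb_or => /andP[/andP[-> ->]]. Qed.

Lemma divf_mulP (a b d : K) : d * (a / b) != 0 -> a != 0 /\ b != 0.
Proof. by rewrite mulrC => /mulf_divP. Qed.

(** Transports nonvanishing between a sum of fractions and its polynomial form after clearing
    denominators, the form in which [field] asks for it. *)
Lemma neq0_clear (a b m : K) : b != 0 -> m != 0 -> a = b * m -> a != 0.
Proof. by move=> b0 m0 ->; rewrite mulf_neq0. Qed.

Ltac dcoords :=
  elim/vec10P => x42 x33 x22 x52 x32 x41 x11 x21 x31 x51 Tx;
  have [[h42 h33 h22 h52 h32] [h41 h11 h21 h31 h51]] :=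
    (torus_vec10P _ _ _ _ _ _ _ _ _ _).1 Tx.

Ltac entries :=
  apply: spin_all; rewrite /raise; cbn [fmove oapp V1_entry].

Ltac unfold_coords := cbn [ec eps scale_factor];
  rewrite /e0_coord /epsilon0_coord /A_coord /B_coord /C_coord
    /e_coord /epsilon_coord ?/ec_cond !with_coords_vec; cbv beta iota zeta.

(** As [0^-1 = 0], a vanishing numerator and a vanishing denominator both produce a zero coordinate,
    so the torus condition detects all the factors in [ec_cond]. *)
Lemma ec_torusP k c x : (k < 6)%N -> c != 0 -> torus K 'I_10 x ->
  torus K 'I_10 (ec k c x) <-> ec_cond k c x.
Proof.
move=> k6 c0; move: x; dcoords.
case: k k6 => [|[|[|[|[|[|//]]]]]] _; unfold_coords; split.
- move=> /torus_vec10P[[/divf_mulP[n42 cd] /divf_mulP[n33 _] _ /divf_mulP[n52 _]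
    /divf_mulP[n32 _]] _].
  by split=> //; move: cd; rewrite mulf_eq0 negb_or => /andP[].
- move=> [d n42 n33 n52 n32].
  by apply/torus_vec10P; rewrite !mulf_neq0 ?invr_eq0 ?mulf_neq0.
- by [].
- by move=> _; apply/torus_vec10P; rewrite mulf_neq0.
- by move=> /torus_vec10P[[_ _ /mulf_divP[n d] _ _] _].
- move=> [n d].
  by apply/torus_vec10P; rewrite !mulf_neq0 ?invr_eq0 ?mulf_neq0 ?invr_eq0.
- by move=> /torus_vec10P[[_ /mulf_divP[n d] _ _ /mulf_divP[n' _]] _].
- move=> [n d n'].
  by apply/torus_vec10P; rewrite !mulf_neq0 ?invr_eq0 ?mulf_neq0 ?invr_eq0.
- by move=> /torus_vec10P[[/mulf_divP[n d] _ _ _ _] _].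
- move=> [n d].
  by apply/torus_vec10P; rewrite !mulf_neq0 ?invr_eq0 ?mulf_neq0 ?invr_eq0.
- by move=> /torus_vec10P[[_ _ _ /mulf_divP[n d] _] _].
move=> [n d].
by apply/torus_vec10P; rewrite !mulf_neq0 ?invr_eq0 ?mulf_neq0 ?invr_eq0.
Qed.

Lemma ec_entries k c x : (k < 6)%N -> c != 0 ->
  torus K 'I_10 x -> ec_cond k c x ->
  eps k x != 0 /\ forall s, sign_prod s ->
    with_coords (@V1_entry K) (ec k c x) s = scale_factor k c *
      raise k ((c - 1) / eps k x) (with_coords (@V1_entry K) x) s.
Proof.
move=> k6 c0; move: x; dcoords.
case: k k6 => [|[|[|[|[|[|//]]]]]] _; unfold_coords.
- move=> [d n42 n33 n52 n32].
  split; first exact: d.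
  (* The primed facts are the conditions of [ec_cond] multiplied by this common denominator. *)
  have m0 : x52 * x42 * x32 * x33 != 0 by rewrite !mulf_neq0.
  have d' : x51 * (x52 * (x42 * x32 * x33)) +
      ((x22 * x31 * x52 + x32 * x31 * x33) * (x42 * x32) +
       (x22 * x21 * (x33 * x32) + x22 * x41 * x21 * x42) * x52) != 0.
    by apply: (neq0_clear d m0); field; nz.
  have n52' : c * x51 * (x52 * (x42 * x32 * x33)) +
      ((x22 * x31 * x52 + x32 * x31 * x33) * (x42 * x32) +
       (x22 * x21 * (x33 * x32) + x22 * x41 * x21 * x42) * x52) != 0.
    by apply: (neq0_clear n52 m0); field; nz.
  have n32' : c * (x51 * (x33 * x52) + (x22 * x31 * x52 + x32 * x31 * x33)) *
      (x42 * x32) + (x22 * x21 * (x33 * x32) + x22 * x41 * x21 * x42) * x52 != 0.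
    by apply: (neq0_clear n32 m0); field; nz.
  have n33' : (c * (x51 * x52 + x32 * x31) * x33 + x22 * x31 * x52) * (x42 * x32) +
      (x22 * x21 * (x33 * x32) + x22 * x41 * x21 * x42) * x52 != 0.
    by apply: (neq0_clear n33 m0); field; nz.
  have n42' : c * ((x51 * (x33 * x52) + (x22 * x31 * x52 + x32 * x31 * x33)) * x32 +
      x22 * x41 * x21 * x52) * x42 + x22 * x21 * (x52 * (x32 * x33)) != 0.
    by apply: (neq0_clear n42 m0); field; nz.
  by entries; field; nz.
- move=> _; split; first by rewrite mulf_neq0 ?invr_eq0.
  by entries; field; nz.
- move=> [n d].
  have -> : x33 / x22 * (1 + x32 * x11 / (x22 * x21)) =
      x33 * (x22 * x21 + x32 * x11) / (x22 ^+ 2 * x21) by field; nz.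
  split; first by rewrite !mulf_neq0 ?invr_eq0 ?mulf_neq0 ?expf_neq0.
  by entries; field; nz.
- move=> [n d n'].
  have -> : x42 / x33 * (1 + x22 * x52 / (x33 * x32)
      + x22 * x52 * x41 * x21 / (x33 * x32 ^+ 2 * x31)) =
      x42 * (x33 * x32 ^+ 2 * x31 + x22 * x52 * x32 * x31
        + x22 * x52 * x41 * x21) / (x33 ^+ 2 * x32 ^+ 2 * x31) by field; nz.
  split; first by rewrite !mulf_neq0 ?invr_eq0 ?mulf_neq0 ?expf_neq0.
  by entries; field; nz.
- move=> [n d].
  have -> : 1 / x42 * (1 + x33 * x32 / (x42 * x41)) =
      (x42 * x41 + x33 * x32) / (x42 ^+ 2 * x41) by field; nz.
  split; first by rewrite !mulf_neq0 ?invr_eq0 ?mulf_neq0 ?expf_neq0.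
  by entries; field; nz.
- move=> [n d].
  have -> : x33 / x52 * (1 + x32 * x31 / (x52 * x51)) =
      x33 * (x52 * x51 + x32 * x31) / (x52 ^+ 2 * x51) by field; nz.
  split; first by rewrite !mulf_neq0 ?invr_eq0 ?mulf_neq0 ?expf_neq0.
  by entries; field; nz.
Qed.

Lemma ec_vec k c x : (k < 6)%N -> c != 0 ->
  torus K 'I_10 x -> torus K 'I_10 (ec k c x) ->
  eps k x != 0 /\
  vat (V1 (ec k c x)) = fun s =>
    scale_factor k c * raise k ((c - 1) / eps k x) (vat (V1 x)) s.
Proof.
move=> k6 c0 Tx Te; have [e0 H] := ec_entries k6 c0 Tx ((ec_torusP k6 c0 Tx).1 Te).
by split=> //; apply: V1_scaled_raise.
Qed.

(** The lower entries of the raised vector express the coordinates of [y] one after the other as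
    those of [ec k c x]; since [y] has no zero coordinate, the numerators in [ec_cond] cannot
    vanish, and [eps k x != 0] handles the denominator. *)
Lemma ec_torus k c x y : (k < 6)%N -> c != 0 ->
  torus K 'I_10 x -> eps k x != 0 -> torus K 'I_10 y ->
  (vat (V1 y) = fun s =>
    scale_factor k c * raise k ((c - 1) / eps k x) (vat (V1 x)) s) ->
  torus K 'I_10 (ec k c x).
Proof.
move=> k6 c0 Tx e0 Ty E; apply/ec_torusP => //.
have {E} H s : sign_prod s -> with_coords (@V1_entry K) y s = scale_factor k c *
    raise k ((c - 1) / eps k x) (with_coords (@V1_entry K) x) s.
  move=> sp; rewrite -V1_at // E /raise V1_at //; congr (_ * (_ + _ * _)).
  by case F: fmove => [t|] //=; rewrite V1_at // (sign_prod_fmove F).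
move: Ty H; elim/vec10P: y => y42 y33 y22 y52 y32 y41 y11 y21 y31 y51.
move=> /torus_vec10P[[k42 k33 k22 k52 k32] _].
move: x Tx e0; dcoords.
case: k k6 => [|[|[|[|[|[|//]]]]]] _; unfold_coords => e0 H.
- have := H (false, false, false, true, false) isT.
  have := H (false, false, true, false, false) isT.
  have := H (false, false, true, true, true) isT.
  have := H (false, true, false, true, true) isT.
  have := H (false, true, false, false, false) isT.
  rewrite /raise /= !mulr0 !addr0 => e22 ef e52 e33 e42.
  have m0 : x52 * x42 * x32 * x33 != 0 by rewrite !mulf_neq0.
  have d' : x51 * (x52 * (x42 * x32 * x33)) +
      ((x22 * x31 * x52 + x32 * x31 * x33) * (x42 * x32) +
       (x22 * x21 * (x33 * x32) + x22 * x41 * x21 * x42) * x52) != 0.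
    by apply: (neq0_clear e0 m0); field; nz.
  have cd : c * (x51 + (x22 * x31 / x33 + x32 * x31 / x52 +
      (x22 * x21 / x42 + x22 * x41 * x21 / (x33 * x32)))) != 0 by rewrite mulf_neq0.
  have n42 : c * (x51 + (x22 * x31 / x33 + x32 * x31 / x52) +
      x22 * x41 * x21 / (x33 * x32)) + x22 * x21 / x42 != 0.
    apply: (neq0_clear k42 (mulf_neq0 cd (invr_neq0 h42))).
    by rewrite e42; field; nz.
  have n33 : c * (x51 + x32 * x31 / x52) + x22 * x31 / x33 +
      (x22 * x21 / x42 + x22 * x41 * x21 / (x33 * x32)) != 0.
    apply: (neq0_clear k33 (mulf_neq0 cd (invr_neq0 h33))).
    by rewrite e33; field; nz.
  have n52 : c * x51 + (x22 * x31 / x33 + x32 * x31 / x52 +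
      (x22 * x21 / x42 + x22 * x41 * x21 / (x33 * x32))) != 0.
    apply: (neq0_clear k52 (mulf_neq0 cd (invr_neq0 h52))).
    by rewrite e52; field; nz.
  have n33' : (c * (x51 * x52 + x32 * x31) * x33 + x22 * x31 * x52) * (x42 * x32) +
      (x22 * x21 * (x33 * x32) + x22 * x41 * x21 * x42) * x52 != 0.
    by apply: (neq0_clear n33 m0); field; nz.
  (* This one comes last: [y32] is not an entry by itself and is isolated from
     [y32 + y22 * y52 / y33] once [y22], [y33] and [y52] are known. *)
  have n32 : c * (x51 + (x22 * x31 / x33 + x32 * x31 / x52)) +
      (x22 * x21 / x42 + x22 * x41 * x21 / (x33 * x32)) != 0.
    apply: (neq0_clear k32 (mulf_neq0 (mulf_neq0 c0 n33) (invr_neq0 h32))).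
    have -> : y32 = c^-1 * (x32 + x22 * x52 / x33) - y22 * y52 / y33.
      by rewrite -ef; field; nz.
    have -> : y33 = x33 * ((c * (x51 + x32 * x31 / x52) + x22 * x31 / x33 +
      (x22 * x21 / x42 + x22 * x41 * x21 / (x33 * x32))) / (c * (x51 +
      (x22 * x31 / x33 + x32 * x31 / x52 +
      (x22 * x21 / x42 + x22 * x41 * x21 / (x33 * x32)))))) by rewrite e33; field; nz.
    by rewrite e22 e52; field; nz.
  by split.
- by [].
- have := H (false, true, false, false, false) isT; rewrite /raise /= mul1r => e22.
  have d : x22 * x21 + x32 * x11 != 0.
    apply: contraNneq e0 => d.
    have -> : x33 / x22 * (1 + x32 * x11 / (x22 * x21)) =
      x33 * (x22 * x21 + x32 * x11) / (x22 ^+ 2 * x21) by field; nz.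
    by rewrite d mulr0 mul0r.
  have n : c * x22 * x21 + x32 * x11 != 0.
    apply: (neq0_clear k22 (mulf_neq0 d (invr_neq0 h22))).
    by rewrite e22; field; nz.
  by split.
- have := H (false, false, true, false, false) isT; rewrite /raise /= !mul1r => e33.
  have := H (false, true, false, false, false) isT.
  have := H (false, false, true, true, true) isT.
  have := H (false, true, false, true, true) isT.
  rewrite /raise /= !mulr0 !addr0 !mul1r => ef e52 e22.
  have e : x42 / x33 * (1 + x22 * x52 / (x33 * x32)
      + x22 * x52 * x41 * x21 / (x33 * x32 ^+ 2 * x31)) =
      x42 * (x33 * x32 ^+ 2 * x31 + x22 * x52 * x32 * x31
        + x22 * x52 * x41 * x21) / (x33 ^+ 2 * x32 ^+ 2 * x31) by field; nz.
  have d : x33 * x32 ^+ 2 * x31 + x22 * x52 * x32 * x31 + x22 * x52 * x41 * x21 != 0.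
    by apply: contraNneq e0 => d; rewrite e d mulr0 mul0r.
  have n : c * (x33 * x32 ^+ 2 * x31) + x22 * x52 * x32 * x31
      + x22 * x52 * x41 * x21 != 0.
    apply: (neq0_clear k33 (mulf_neq0 d (invr_neq0 h33))).
    by rewrite e33 e; field; nz.
  have n' : c * (x33 * x32 ^+ 2 * x31) + c * (x22 * x52 * x32 * x31)
      + x22 * x52 * x41 * x21 != 0.
    apply: (neq0_clear k32 (mulf_neq0 n (invr_neq0 h32))).
    have -> : y32 = x32 + x22 * x52 / x33 - y22 * y52 / y33 by rewrite -ef; field; nz.
    have -> : y33 = (c * (x33 * x32 ^+ 2 * x31) + x22 * x52 * x32 * x31
        + x22 * x52 * x41 * x21) /
      (x33 * x32 ^+ 2 * x31 + x22 * x52 * x32 * x31 + x22 * x52 * x41 * x21) * x33.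
      by rewrite e33 e; field; nz.
    by rewrite e22 e52; field; nz.
  by split.
- have := H (false, false, false, true, false) isT; rewrite /raise /= mul1r => e42.
  have d : x42 * x41 + x33 * x32 != 0.
    apply: contraNneq e0 => d.
    have -> : 1 / x42 * (1 + x33 * x32 / (x42 * x41)) =
      (x42 * x41 + x33 * x32) / (x42 ^+ 2 * x41) by field; nz.
    by rewrite d mul0r.
  have n : c * x42 * x41 + x33 * x32 != 0.
    apply: (neq0_clear k42 (mulf_neq0 d (invr_neq0 h42))).
    by rewrite e42; field; nz.
  by split.
have := H (false, false, true, true, true) isT; rewrite /raise /= mul1r => e52.
have d : x52 * x51 + x32 * x31 != 0.
  apply: contraNneq e0 => d.
  have -> : x33 / x52 * (1 + x32 * x31 / (x52 * x51)) =
    x33 * (x52 * x51 + x32 * x31) / (x52 ^+ 2 * x51) by field; nz.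
  by rewrite d mulr0 mul0r.
have n : c * x52 * x51 + x32 * x31 != 0.
  apply: (neq0_clear k52 (mulf_neq0 d (invr_neq0 h52))).
  by rewrite e52; field; nz.
by split.
Qed.

(** * Minors, their derivatives, and their values on [V1] *)

Definition adjacent (i j : nat) : bool :=
  ((i, j) \in D5_edges) || ((j, i) \in D5_edges).

(* [Pmin k] is the restriction of an extremal minor of the [k]-th            *)
(* fundamental representation, [Qmin k] its derivative along [e_k], and      *)
(* [Rmin i j] the derivative of [Qmin j] along [e_i].                        *)
Definition Pmin k w : K :=
  match k with
  | 0 => w (false, false, false, false, true)
  | 1 => w (true, false, false, false, false)
  | 2 => w (false, true, false, false, false) * w (true, false, false, true, true)
         - w (true, false, false, false, false) * w (false, true, false, true, true)
  | 3 => w (false, false, true, true, true) * w (true, true, true, false, false)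
         - w (false, false, true, false, false) * w (true, true, true, true, true)
  | 4 => w (false, true, true, true, false)
  | _ => w (true, true, true, true, true)
  end.

Definition Qmin k w : K :=
  match k with
  | 0 => w (true, true, false, false, true)
  | 1 => w (false, true, false, false, false)
  | 2 => w (false, false, true, false, false) * w (true, false, false, true, true)
         - w (false, false, true, true, true) * w (true, false, false, false, false)
  | 3 => w (false, false, true, true, true) * w (true, true, false, true, false)
         - w (false, false, false, true, false) * w (true, true, true, true, true)
  | 4 => w (false, true, true, false, true)
  | _ => w (true, true, true, false, false)
  end.

Definition Rmin i j w : K :=
  match i, j with
  | 0, 2 => w (true, true, true, false, false) * w (true, false, false, true, true)
            - w (true, true, true, true, true) * w (true, false, false, false, false)
  | 2, 0 => w (true, false, true, false, true)
  | 1, 2 => w (false, false, true, false, false) * w (false, true, false, true, true)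
            - w (false, false, true, true, true) * w (false, true, false, false, false)
  | 2, 1 => w (false, false, true, false, false)
  | 2, 3 => w (false, false, true, true, true) * w (true, false, true, true, false)
  | 3, 2 => w (false, false, false, true, false) * w (true, false, false, true, true)
  | 3, 4 => w (false, true, false, true, true)
  | 4, 3 => w (false, false, true, true, true) * w (true, true, false, false, true)
            - w (false, false, false, false, true) * w (true, true, true, true, true)
  | 3, 5 => w (true, true, false, true, false)
  | 5, 3 => w (false, false, true, false, false) * w (true, true, false, true, false)
            - w (false, false, false, true, false) * w (true, true, true, false, false)
  | _, _ => 0
  end.

Definition degmin k : nat := match k with 2 | 3 => 2 | _ => 1 end.

Ltac case6 k := case: k => [|[|[|[|[|[|k]]]]]] //.
Ltac minors := rewrite /raise /=; ring.

(** In each monomial of the minor at most one factor is moved by [e_k], so even the quadratic minors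
    contribute no term in [a ^+ 2]. *)
Lemma Pmin_raise_same k a w : (k < 6)%N ->
  Pmin k (raise k a w) = Pmin k w + a * Qmin k w.
Proof. by case6 k; move=> _; minors. Qed.

Lemma Pmin_raise i j a w : (i < 6)%N -> (j < 6)%N -> i != j ->
  Pmin j (raise i a w) = Pmin j w.
Proof. by case6 i; case6 j; move=> _ _ _; minors. Qed.

Lemma Qmin_raise_same k a w : (k < 6)%N -> Qmin k (raise k a w) = Qmin k w.
Proof. by case6 k; move=> _; minors. Qed.

Lemma Qmin_raise i j a w : (i < 6)%N -> (j < 6)%N -> ~~ adjacent i j ->
  Qmin j (raise i a w) = Qmin j w.
Proof. by case6 i; case6 j; move=> _ _ _; minors. Qed.

Lemma Rmin_raise_l i j a w : adjacent i j -> Rmin i j (raise i a w) = Rmin i j w.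
Proof. by case6 i; case6 j; move=> _; minors. Qed.

(** As [Rmin i j] comes from [Pmin j] by [e_j] and then [e_i], this says that [e_j e_i e_j] kills
    the extremal minor. *)
Lemma Rmin_raise_r i j a w : adjacent i j -> Rmin i j (raise j a w) = Rmin i j w.
Proof. by case6 i; case6 j; move=> _; minors. Qed.

Lemma Pmin_scale k l w : (k < 6)%N ->
  Pmin k (fun s => l * w s) = l ^+ degmin k * Pmin k w.
Proof. by case6 k; move=> _ /=; ring. Qed.

Lemma Qmin_scale k l w : (k < 6)%N ->
  Qmin k (fun s => l * w s) = l ^+ degmin k * Qmin k w.
Proof. by case6 k; move=> _ /=; ring. Qed.

Lemma Rmin_scale i j l w : adjacent i j ->
  Rmin i j (fun s => l * w s) = l ^+ degmin j * Rmin i j w.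
Proof. by case6 i; case6 j; move=> _ /=; ring. Qed.

(** The minor [Pmin k] on [V1 x] is the product of all coordinates of lower index [k] (empty for
    [k = 0]). Being a monomial, it vanishes nowhere on the torus. *)
Definition p_coord k : aff K 'I_10 -> K :=
  with_coords (fun x42 x33 x22 x52 x32 x41 x11 x21 x31 x51 =>
    match k with
    | 0 => 1
    | 1 => x11
    | 2 => x22 * x21
    | 3 => x33 * x32 * x31
    | 4 => x42 * x41
    | _ => x52 * x51
    end).

Lemma p_coord_neq0 k x : torus K 'I_10 x -> p_coord k x != 0.
Proof.
move: x; dcoords; rewrite /p_coord with_coords_vec.
by case6 k; rewrite ?mulf_neq0 ?oner_neq0.
Qed.

Lemma Pmin_V1 k x : torus K 'I_10 x -> Pmin k (vat (V1 x)) = p_coord k x.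
Proof.
move: x; dcoords.
rewrite /p_coord with_coords_vec; case6 k; rewrite /=;
  rewrite !V1_at // with_coords_vec;
  cbn [V1_entry]; field; nz.
Qed.

Lemma eps_V1 k x : torus K 'I_10 x -> (k < 6)%N ->
  eps k x = Qmin k (vat (V1 x)) / p_coord k x.
Proof.
move: x; dcoords.
case6 k; move=> _; rewrite /p_coord; unfold_coords; cbn [Qmin];
  rewrite !V1_at // !with_coords_vec; cbn [V1_entry]; field; nz.
Qed.

(** A three-term relation of Plücker type. It is not an identity between sixteen free entries: it
    holds on the image of [V1], hence the verification in coordinates. *)
Lemma PQR_V1 i j x : torus K 'I_10 x -> adjacent i j ->
  Pmin i (vat (V1 x)) * Rmin i j (vat (V1 x)) +
  Pmin j (vat (V1 x)) * Rmin j i (vat (V1 x)) =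
  Qmin i (vat (V1 x)) * Qmin j (vat (V1 x)).
Proof.
move: x; dcoords.
case6 i; case6 j; move=> _ /=; rewrite !V1_at // !with_coords_vec;
  cbn [V1_entry]; field; nz.
Qed.

(* The Dynkin diagram automorphism exchanging 0 with 1 and 4 with 5.         *)
Definition flip (s : signs) : signs :=
  let: (i1, i2, i3, i4, i5) := s in (~~ i1, i2, i3, i4, ~~ i5).

Definition flip_node k := nth k [:: 1; 0; 2; 3; 5; 4]%N k.

Lemma rawY_flip k c w : (k < 6)%N ->
  rawY (flip_node k) c (fun s => w (flip s)) = fun s => rawY k c w (flip s).
Proof.
move=> k6; apply/funext => -[[[[i1 i2] i3] i4] i5]; rewrite /rawY.
move: k k6; case=> [|[|[|[|[|[|k]]]]]] // _;
  by case: i1 => //; case: i2 => //; case: i3 => //; case: i4 => //; case: i5.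
Qed.

(** The word of [V2] is that of [V1] with the nodes 0, 1 and the nodes 4, 5 exchanged, and [flip]
    exchanges the two starting vectors. So [V2] needs no chart of its own. *)
Lemma V2_at y : torus K 'I_10 y -> vat (V2 y) = fun s => vat (V1 y) (flip s).
Proof.
elim/vec10P: y => x42 x33 x22 x52 x32 x41 x11 x21 x31 x51.
move=> /torus_vec10P[[h42 h33 h22 h52 h32] [h41 h11 h21 h31 h51]].
transitivity (rawY 5 x42 (rawY 3 x33 (rawY 2 x22 (rawY 4 x52 (rawY 3 x32
    (rawY 5 x41 (rawY 0 x11 (rawY 2 x21 (rawY 3 x31 (rawY 4 x51
    (fun s => (s == (false, true, true, true, false))%:R))))))))))).
  rewrite /V2 with_coords_vec; do 10![rewrite vatY; last by []].
  by rewrite vat_basis.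
rewrite /V1 with_coords_vec; do 10![rewrite vatY; last by []].
rewrite vat_basis; last by [].
rewrite -(rawY_flip (k := 4)) ; last (by []); congr rawY.
rewrite -(rawY_flip (k := 3)) ; last (by []); congr rawY.
rewrite -(rawY_flip (k := 2)) ; last (by []); congr rawY.
rewrite -(rawY_flip (k := 5)) ; last (by []); congr rawY.
rewrite -(rawY_flip (k := 3)) ; last (by []); congr rawY.
rewrite -(rawY_flip (k := 4)) ; last (by []); congr rawY.
rewrite -(rawY_flip (k := 1)) ; last (by []); congr rawY.
rewrite -(rawY_flip (k := 2)) ; last (by []); congr rawY.
rewrite -(rawY_flip (k := 3)) ; last (by []); congr rawY.
rewrite -(rawY_flip (k := 5)) ; last (by []); congr rawY.
by apply/funext => -[[[[[] []] []] []] []].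
Qed.

Lemma flipK : involutive flip.
Proof. by case=> [[[[i1 i2] i3] i4] i5] /=; rewrite !negbK. Qed.

Lemma V2_inj x y : torus K 'I_10 x -> torus K 'I_10 y -> V2 x = V2 y -> x = y.
Proof.
move=> Tx Ty /(congr1 (fun v => vat v)); rewrite V2_at // V2_at // => E.
apply: (V1_inj Tx Ty); apply: vat_inj => s.
by have := congr1 (fun f => f (flip s)) E; rewrite /= flipK.
Qed.

(* The Dynkin diagram automorphism behind [sigma_bar].                       *)
Definition rot (s : signs) : signs :=
  let: (i1, i2, i3, i4, i5) := s in (i5, ~~ i4, ~~ i3, ~~ i2, ~~ i1).

Definition unrot (s : signs) : signs :=
  let: (i1, i2, i3, i4, i5) := s in (~~ i5, ~~ i4, ~~ i3, ~~ i2, i1).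

Lemma unrotK s : rot (unrot s) = s.
Proof. by case: s => [[[[i1 i2] i3] i4] i5] /=; rewrite !negbK. Qed.

Lemma sign_prod_rot s : sign_prod (rot s) = sign_prod s.
Proof. by case: s => [[[[[] []] []] []] []]. Qed.

Lemma raise_rot a w :
  raise 4 a (fun s => w (rot s)) = fun s => raise 0 a w (rot s).
Proof.
by apply/funext => -[[[[i1 i2] i3] [] ] []]; rewrite /raise.
Qed.

Definition sigma_cond : aff K 'I_10 -> Prop :=
  with_coords (fun x42 x33 x22 x52 x32 x41 x11 x21 x31 x51 =>
    [/\ x52 / x33 + x32 / x22 + x21 / x11 != 0, x22 / x33 + x32 / x52 != 0,
      x33 * x32 / (x42 * x52) + x41 / x52 != 0
      & x22 * x31 / x33 + x32 * x31 / x52 +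
        (x22 * x21 / x42 + x22 * x41 * x21 / (x33 * x32)) != 0]).

Lemma sigma_torusP x : torus K 'I_10 x ->
  torus K 'I_10 (sigma_coord x) <-> sigma_cond x.
Proof.
move: x; dcoords.
rewrite /sigma_cond /sigma_coord /A_coord /B_coord /C_coord !with_coords_vec.
cbv beta iota zeta; split.
  move=> /torus_vec10P[[_ h3 h2 h4 _] [_ _ _ ha hq]].
  move: h3 h2 ha hq; rewrite !mulf_eq0 !invr_eq0 !negb_or.
  by move=> /andP[_ ?] /andP[_ ?] /andP[_ ?] ?; split.
move=> [q d n a]; apply/torus_vec10P.
by rewrite !mulf_neq0 ?invr_eq0 ?mulf_neq0 ?invr_eq0 ?oner_neq0 ?expf_neq0.
Qed.

(** The scalar is forced: [rot] sends the lowest sign vector to the all-plus one, whose entry in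
    [V1 x] is [p_coord 5 x], and the lowest entry on the left is 1. *)
Lemma V1_sigma x : torus K 'I_10 x -> torus K 'I_10 (sigma_coord x) ->
  vat (V1 (sigma_coord x)) = fun s => (p_coord 5 x)^-1 * vat (V1 x) (rot s).
Proof.
move=> Tx Ts; apply/funext => s.
have [sp|sp] := boolP (sign_prod s); last first.
  by rewrite !vat_odd ?sign_prod_rot // mulr0.
rewrite !V1_at ?sign_prod_rot //.
move: s sp Ts; move: x Tx; dcoords => s sp /(sigma_torusP Tx); move: s sp.
rewrite /sigma_cond /sigma_coord /A_coord /B_coord /C_coord /p_coord !with_coords_vec.
cbv beta iota zeta => s sp [q d n a]; move: s sp.
have q' : (x52 * x22 + x32 * x33) * x11 + x21 * (x33 * x22) != 0.
  by apply: (neq0_clear q (mulf_neq0 (mulf_neq0 h33 h22) h11)); field; nz.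
have d' : x22 * x52 + x32 * x33 != 0.
  by apply: (neq0_clear d (mulf_neq0 h33 h52)); field; nz.
have n' : x33 * x32 + x41 * x42 != 0.
  by apply: (neq0_clear n (mulf_neq0 h42 h52)); field; nz.
have a' : (x22 * x31 * x52 + x32 * x31 * x33) * (x42 * x32) +
    (x22 * x21 * (x33 * x32) + x22 * x41 * x21 * x42) * x52 != 0.
  apply: (neq0_clear a (mulf_neq0 (mulf_neq0 (mulf_neq0 h33 h52) h42) h32)).
  by field; nz.
by apply: spin_all; cbn [rot negb V1_entry]; field; nz.
Qed.

(** Rewritten on the vector, the four conditions are visibly stable under [e_0]: it moves none of
    the three entries, and in [Rmin 4 3] its two contributions cancel. *)
Lemma sigma_condE x : torus K 'I_10 x ->
  sigma_cond x <-> [/\ vat (V1 x) (true, false, false, true, true) != 0,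
    vat (V1 x) (false, true, false, true, true) != 0,
    vat (V1 x) (false, true, true, false, true) != 0 &
    Rmin 4 3 (vat (V1 x)) != 0].
Proof.
move: x; dcoords; rewrite /sigma_cond /= !V1_at // !with_coords_vec.
cbn [V1_entry]; split=> -[q d n a]; split.
- by apply: (neq0_clear q h11); field; nz.
- by apply: (neq0_clear d h52); field; nz.
- by apply: (neq0_clear n h52); field; nz.
- by apply: (neq0_clear a h52); field; nz.
- by apply: (neq0_clear q (invr_neq0 h11)); field; nz.
- by apply: (neq0_clear d (invr_neq0 h52)); field; nz.
- by apply: (neq0_clear n (invr_neq0 h52)); field; nz.
by apply: (neq0_clear a (invr_neq0 h52)); field; nz.
Qed.

Lemma sigma_cond_raise a l x y : torus K 'I_10 x -> torus K 'I_10 y -> l != 0 ->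
  (vat (V1 y) = fun s => l * raise 0 a (vat (V1 x)) s) ->
  sigma_cond x -> sigma_cond y.
Proof.
move=> Tx Ty l0 E /(sigma_condE Tx)[q d n r]; apply/(sigma_condE Ty); rewrite E.
by split; rewrite ?Rmin_scale // /raise /= ?mulr0 ?addr0 mulf_neq0 ?expf_neq0 //;
  apply: (neq0_clear r (oner_neq0 _)); rewrite /=; ring.
Qed.

Lemma eps_sigma x : torus K 'I_10 x -> torus K 'I_10 (sigma_coord x) ->
  eps 4 (sigma_coord x) = eps 0 x.
Proof.
move=> Tx Ts; rewrite !eps_V1 // -!Pmin_V1 // V1_sigma //.
have -> w l : Qmin 4 (fun s => l * w (rot s)) = l * Qmin 0 w by [].
have -> w l : Pmin 4 (fun s => l * w (rot s)) = l * Pmin 0 w by [].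
by rewrite -mulf_div divff ?mul1r // invr_eq0 p_coord_neq0.
Qed.

Lemma eps0_V1 x : torus K 'I_10 x ->
  eps 0 x = vat (V1 x) (true, true, false, false, true).
Proof.
move=> Tx; rewrite eps_V1 //.
have -> : p_coord 0 x = 1 by []; exact: divr1.
Qed.

Lemma V1_low x : torus K 'I_10 x -> vat (V1 x) (false, false, false, false, true) = 1.
Proof. by move=> Tx; rewrite -[LHS]/(Pmin 0 (vat (V1 x))) Pmin_V1. Qed.

(** Both sides describe [V1 x'] as a multiple of the same raised vector, since [rot] carries [e_4]
    to [e_0] and [eps 4] at [sigma_coord x] is [eps 0] at [x]. Torus membership has to be
    transferred along with the equation. *)
Lemma sigma_ec c x x' : c != 0 -> torus K 'I_10 x -> torus K 'I_10 x' ->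
  torus K 'I_10 (sigma_coord x) ->
  torus K 'I_10 (sigma_coord x') /\
  torus K 'I_10 (ec 4 c (sigma_coord x)) /\
    sigma_coord x' = ec 4 c (sigma_coord x) <->
  torus K 'I_10 (ec 0 c x) /\ x' = ec 0 c x.
Proof.
move=> c0 Tx Tx' Ts; set a := (c - 1) / eps 0 x.
have p0 : p_coord 5 x != 0 by exact: p_coord_neq0.
have p0' : p_coord 5 x' != 0 by exact: p_coord_neq0.
split.
  move=> [Ts' [Te E]]; have [e0] := ec_vec (isT : (4 < 6)%N) c0 Ts Te.
  rewrite -E V1_sigma // V1_sigma // eps_sigma // -/a => EV.
  rewrite eps_sigma // in e0.
  have {}EV t : vat (V1 x') t =
      p_coord 5 x' / p_coord 5 x * raise 0 a (vat (V1 x)) t.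
    have /(congr1 (fun f => f (unrot t))) := EV.
    rewrite /= mul1r unrotK => /(congr1 (fun z => p_coord 5 x' * z)).
    rewrite mulrA divff // mul1r => ->; rewrite -mulrA; congr (_ * _).
    transitivity ((p_coord 5 x)^-1 * raise 4 a (fun s => vat (V1 x) (rot s)) (unrot t)).
      by rewrite /raise; case: fmove => [s|] /=; ring.
    by rewrite raise_rot unrotK.
  (* In the lowest entry the raised vector equals [1 + a * eps 0 x = c], while [V1 x'] has 1
     there. *)
  have l : p_coord 5 x' / p_coord 5 x = c^-1.
    have := EV (false, false, false, false, true).
    rewrite V1_low // /raise /= V1_low // -eps0_V1 // /a divfK // addrCA subrr addr0.
    by move=> e; apply: (mulIf c0); rewrite mulVf // -e.
  rewrite l in EV.
  have {}EV : vat (V1 x') = fun s =>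
      scale_factor 0 c * raise 0 ((c - 1) / eps 0 x) (vat (V1 x)) s by apply/funext.
  have Te0 := ec_torus (isT : (0 < 6)%N) c0 Tx e0 Tx' EV; split=> //.
  have [_ EV'] := ec_vec (isT : (0 < 6)%N) c0 Tx Te0.
  by apply: (V1_inj Tx' Te0); apply: vat_inj => s; rewrite EV EV'.
move=> [Te E]; have [e0] := ec_vec (isT : (0 < 6)%N) c0 Tx Te.
rewrite -E -/a => EV.
have ci : scale_factor 0 c != 0 by rewrite invr_eq0.
have Ts' : torus K 'I_10 (sigma_coord x').
  apply/(sigma_torusP Tx'); apply: (sigma_cond_raise Tx Tx' ci EV).
  exact/sigma_torusP.
(* [Pmin 5] is unaffected by [e_0], so only the scalar is felt. *)
have l : p_coord 5 x' = c^-1 * p_coord 5 x.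
  by rewrite -!Pmin_V1 // EV Pmin_scale // Pmin_raise // expr1.
have EV4 : vat (V1 (sigma_coord x')) = fun s => scale_factor 4 c *
    raise 4 ((c - 1) / eps 4 (sigma_coord x)) (vat (V1 (sigma_coord x))) s.
  rewrite eps_sigma // -/a V1_sigma // V1_sigma // EV l.
  apply/funext => s; rewrite [scale_factor 4 c]/(1) mul1r.
  transitivity ((p_coord 5 x)^-1 * raise 4 a (fun s => vat (V1 x) (rot s)) s).
    by rewrite raise_rot /scale_factor; field; nz.
  by rewrite /raise; case: fmove => [t|] /=; ring.
have e4 : eps 4 (sigma_coord x) != 0 by rewrite eps_sigma.
have T4 := ec_torus (isT : (4 < 6)%N) c0 Ts e4 Ts' EV4; do 2!split=> //.
have [_ EV'] := ec_vec (isT : (4 < 6)%N) c0 Ts T4.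
by apply: (V1_inj Ts' T4); apply: vat_inj => s; rewrite EV4 EV'.
Qed.

(** In the numbering by order of occurrence, [ebar5_coord c] and [ec 4 c] are convertible; together
    with the injectivity of [V1] and [V2] this turns the composite relation into [sigma_ec]. *)
Lemma e0E c x v : c != 0 -> torus K 'I_10 x ->
  e0 c (V1 x) v <->
  (torus K 'I_10 (sigma_coord x) /\ torus K 'I_10 (ec 0 c x)) /\
  v = V1 (ec 0 c x).
Proof.
move=> c0 Tx; split.
  move=> [_ [_ [x1 [Tx1 Ts1 Ex ->]] [y [Ty Te Ey ->]]] [x' [Tx' Ts' -> E']]].
  have {}Ex := V1_inj Tx Tx1 Ex; subst x1.
  have {}Ey := V2_inj Ts1 Ty Ey; subst y.
  have {}E' := V2_inj Te Ts' E'.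
  by have [Te0 ->] := (sigma_ec c0 Tx Tx' Ts1).1 (conj Ts' (conj Te (esym E'))).
move=> [[Ts Te] ->].
have [Ts' [Te4 E]] := (sigma_ec c0 Tx Te Ts).2 (conj Te erefl).
exists (V2 (ec 4 c (sigma_coord x))); last by exists (ec 0 c x); rewrite E.
exists (V2 (sigma_coord x)); first by exists x.
by exists (sigma_coord x).
Qed.

Lemma chart_sigmaE (f : aff K 'I_10 -> K) x b : torus K 'I_10 x ->
  rcomp (chart_fun (@V2 K) f) (@sigma_bar K) (V1 x) b <->
  torus K 'I_10 (sigma_coord x) /\ b = f (sigma_coord x).
Proof.
move=> Tx; split.
  move=> [_ [x1 [Tx1 Ts1 Ex ->]] [y [Ty Ey ->]]].
  have {}Ex := V1_inj Tx Tx1 Ex; subst x1.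
  by have {}Ey := V2_inj Ts1 Ty Ey; subst y.
move=> [Ts ->]; exists (V2 (sigma_coord x)); first by exists x.
by exists (sigma_coord x).
Qed.

Lemma gamma0E x b : torus K 'I_10 x ->
  gamma0 (V1 x) b <->
  torus K 'I_10 (sigma_coord x) /\ b = gamma0_coord x.
Proof.
move=> Tx; rewrite /gamma0 chart_sigmaE //.
suff E : torus K 'I_10 (sigma_coord x) ->
  gammabar5_coord (sigma_coord x) = gamma0_coord x.
  by split=> -[Ts ->]; rewrite E.
move=> /(sigma_torusP Tx); move: x Tx; dcoords.
rewrite /sigma_cond /gamma0_coord /gammabar5_coord /sigma_coord /A_coord /B_coord
  /C_coord !with_coords_vec; cbv beta iota zeta => -[q d n a].
have d' : x22 * x52 + x32 * x33 != 0.
  by apply: (neq0_clear d (mulf_neq0 h33 h52)); field; nz.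
have a' : (x22 * x31 * x52 + x32 * x31 * x33) * (x42 * x32) +
    (x22 * x21 * (x33 * x32) + x22 * x41 * x21 * x42) * x52 != 0.
  apply: (neq0_clear a (mulf_neq0 (mulf_neq0 (mulf_neq0 h33 h52) h42) h32)).
  by field; nz.
by field; nz.
Qed.

Lemma epsilon0E x b : torus K 'I_10 x ->
  epsilon0 (V1 x) b <->
  torus K 'I_10 (sigma_coord x) /\ b = epsilon0_coord x.
Proof.
move=> Tx; rewrite /epsilon0 chart_sigmaE //.
suff E : torus K 'I_10 (sigma_coord x) ->
  epsilonbar5_coord (sigma_coord x) = epsilon0_coord x.
  by split=> -[Ts ->]; rewrite E.
exact: eps_sigma.
Qed.

(** * Commutation and Verma relations *)

Definition shift k w (s : signs) : K := oapp w 0 (fmove k s).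

Lemma raiseE k a w s : raise k a w s = w s + a * shift k w s.
Proof. by []. Qed.

Lemma shiftD k a w w' s :
  shift k (fun t => w t + a * w' t) s = shift k w s + a * shift k w' s.
Proof. by rewrite /shift; case: fmove => [t|] //=; rewrite mulr0 addr0. Qed.

Lemma shift_raise i j a w s :
  shift i (raise j a w) s = shift i w s + a * shift i (shift j w) s.
Proof. exact: shiftD. Qed.

Lemma eq_shift k w w' s : w =1 w' -> shift k w s = shift k w' s.
Proof. by move=> e; rewrite /shift; case: fmove => [t|] //=. Qed.

Lemma shift_shift_same k w s : shift k (shift k w) s = 0.
Proof.
by rewrite /shift; move: s => [[[[[] []] []] []] []]; case6 k.
Qed.

Lemma shift_shift_far i j w s : ~~ adjacent i j ->
  shift i (shift j w) s = shift j (shift i w) s.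
Proof.
rewrite /shift; case6 i; case6 j; move=> _;
  by move: s => [[[[i1 i2] i3] i4] i5];
     case: i1 => //; case: i2 => //; case: i3 => //; case: i4 => //; case: i5.
Qed.

Lemma shift_shift_adjacent i j w s : adjacent i j ->
  shift i (shift j (shift i w)) s = 0.
Proof.
rewrite /shift; case6 i; case6 j; move=> _;
  by move: s => [[[[i1 i2] i3] i4] i5];
     case: i1 => //; case: i2 => //; case: i3 => //; case: i4 => //; case: i5.
Qed.

Lemma raise_scale k a l w :
  raise k a (fun s => l * w s) = fun s => l * raise k a w s.
Proof.
by apply/funext => s; rewrite /raise; case: fmove => [t|] /=; ring.
Qed.

Lemma raise_add k a b w : raise k a (raise k b w) = raise k (a + b) w.
Proof.
apply/funext => s.
rewrite !raiseE shift_raise shift_shift_same; ring.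
Qed.

Lemma raise_far i j a b w : ~~ adjacent i j ->
  raise i a (raise j b w) = raise j b (raise i a w).
Proof.
move=> nij; apply/funext => s.
rewrite !raiseE !shift_raise [shift i (shift j w) s]shift_shift_far //; ring.
Qed.

Lemma shift_raise_raise i j k a b w s : shift k (raise i a (raise j b w)) s =
  shift k w s + b * shift k (shift j w) s + a * shift k (shift i w) s +
  a * b * shift k (shift i (shift j w)) s.
Proof.
rewrite !shift_raise (eq_shift _ _ (shift_raise i j b w)) shiftD; ring.
Qed.

Lemma raise_braid i j a b d a' s' d' w : adjacent i j ->
  s' = a + d -> b = a' + d' -> s' * a' = a * b -> d' * s' = b * d ->
  raise i a (raise j b (raise i d w)) = raise j d' (raise i s' (raise j a' w)).
Proof.
move=> ij e1 e2 e3 e4; apply/funext => s.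
have ji : adjacent j i by rewrite /adjacent orbC.
rewrite !(raiseE, shift_raise_raise, shift_raise) !shift_shift_same.
rewrite (shift_shift_adjacent _ _ ij) (shift_shift_adjacent _ _ ji).
(* Normal form: words of length three in [e_i], [e_j] vanish, so only five coefficients are left to
   compare, and the four equations match them. *)
transitivity (w s + (a + d) * shift i w s + b * shift j w s
  + (a * b) * shift i (shift j w) s + (b * d) * shift j (shift i w) s).
  by ring.
by rewrite -e3 -e4 -e1 {1}e2; ring.
Qed.

Lemma adjacent_neq i j : adjacent i j -> (i == j) = false.
Proof. by apply: contraTF => /eqP ->; case6 j. Qed.

(** The lowest entry of both vectors is 1, so proportionality is equality. Composites therefore need
    to be compared only up to scalars. *)
Lemma V1_proportional x y l : torus K 'I_10 x -> torus K 'I_10 y ->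
  (forall s, vat (V1 y) s = l * vat (V1 x) s) -> y = x.
Proof.
move=> Tx Ty E; have := E (false, false, false, false, true).
rewrite !V1_low // mulr1 => /esym l1.
by apply: (V1_inj Ty Tx); apply: vat_inj => s; rewrite E l1 mul1r.
Qed.

Section Step.
Variables (k : nat) (c : K) (x : aff K 'I_10).
Hypotheses (k6 : (k < 6)%N) (c0 : c != 0).
Hypotheses (Tx : torus K 'I_10 x) (Te : torus K 'I_10 (ec k c x)).

Lemma ec_eps_neq0 : eps k x != 0.
Proof. by have [] := ec_vec k6 c0 Tx Te. Qed.

Lemma ec_V1 : vat (V1 (ec k c x)) = fun s =>
    scale_factor k c * raise k ((c - 1) / eps k x) (vat (V1 x)) s.
Proof. by have [] := ec_vec k6 c0 Tx Te. Qed.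

Lemma scale_factor_neq0 : scale_factor k c != 0.
Proof. by case: (k) => [|k'] /=; rewrite ?invr_eq0 ?oner_neq0. Qed.

Lemma p_coord_ec j : (j < 6)%N ->
  p_coord j (ec k c x) = scale_factor k c ^+ degmin j *
    ((if k == j then c else 1) * p_coord j x).
Proof.
move=> j6; rewrite -!Pmin_V1 // ec_V1 Pmin_scale //; congr (_ * _).
have [<-|kj] := eqVneq k j; last by rewrite Pmin_raise // mul1r.
rewrite Pmin_raise_same //.
have e : Qmin k (vat (V1 x)) = eps k x * Pmin k (vat (V1 x)).
  by rewrite eps_V1 // Pmin_V1 // divfK // p_coord_neq0.
have := ec_eps_neq0; rewrite e => h; field; nz.
Qed.

(** [Qmin k] is fixed and [Pmin k] is multiplied by [c]; the two have the same degree, so the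
    overall scalar cancels. *)
Lemma eps_ec_same : eps k (ec k c x) = eps k x / c.
Proof.
rewrite !eps_V1 // p_coord_ec // eqxx ec_V1 Qmin_scale // Qmin_raise_same //.
have h := p_coord_neq0 k Tx.
have h' : scale_factor k c ^+ degmin k != 0 by rewrite expf_neq0 ?scale_factor_neq0.
move: h h'; set u := _ ^+ _; set v := p_coord k x => h h'.
by field; nz.
Qed.

Lemma eps_ec_far j : (j < 6)%N -> k != j -> ~~ adjacent k j ->
  eps j (ec k c x) = eps j x.
Proof.
move=> j6 kj nkj.
rewrite !eps_V1 // p_coord_ec // (negPf kj) ec_V1 Qmin_scale // Qmin_raise //.
have h := p_coord_neq0 j Tx.
have h' : scale_factor k c ^+ degmin j != 0 by rewrite expf_neq0 ?scale_factor_neq0.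
move: h h'; set u := _ ^+ _; set v := p_coord j x => h h'.
by field; nz.
Qed.

Definition rho i j y : K := Rmin i j (vat (V1 y)) / p_coord j y.

Lemma rho_ec_l j : (j < 6)%N -> adjacent k j -> rho k j (ec k c x) = rho k j x.
Proof.
move=> j6 kj; rewrite /rho p_coord_ec // ec_V1 Rmin_scale // Rmin_raise_l //.
rewrite (adjacent_neq kj).
have h := p_coord_neq0 j Tx.
have h' : scale_factor k c ^+ degmin j != 0 by rewrite expf_neq0 ?scale_factor_neq0.
move: h h'; set u := _ ^+ _; set v := p_coord j x => h h'.
by field; nz.
Qed.

Lemma rho_ec_r j : adjacent j k -> rho j k (ec k c x) = rho j k x / c.
Proof.
move=> kj; rewrite /rho p_coord_ec // ec_V1 Rmin_scale // Rmin_raise_r // eqxx.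
have h := p_coord_neq0 k Tx.
have h' : scale_factor k c ^+ degmin k != 0 by rewrite expf_neq0 ?scale_factor_neq0.
move: h h'; set u := _ ^+ _; set v := p_coord k x => h h'.
by field; nz.
Qed.

End Step.

Lemma rho_sum i j x : (i < 6)%N -> (j < 6)%N -> torus K 'I_10 x -> adjacent i j ->
  rho i j x + rho j i x = eps i x * eps j x.
Proof.
move=> i6 j6 Tx ij; rewrite /rho !eps_V1 //.
have hi := p_coord_neq0 i Tx; have hj := p_coord_neq0 j Tx.
rewrite mulf_div -(PQR_V1 Tx ij) !Pmin_V1 //.
by field; nz.
Qed.

Lemma scale_factorM k (c d : K) :
  scale_factor k (c * d) = scale_factor k c * scale_factor k d.
Proof. by case: k => [|k] /=; rewrite ?invfM ?mulr1. Qed.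

Lemma scale_factor1 k : scale_factor k 1 = 1 :> K.
Proof. by case: k => [|k]; [exact: invr1 | ]. Qed.

(** Exponents add: after [e_k^c2] the value of [eps] is [eps k x / c2], and
    [(c2 - 1) + (c1 - 1) * c2 = c1 * c2 - 1]. *)
Lemma ec_mul k c1 c2 x : (k < 6)%N -> c1 != 0 -> c2 != 0 -> torus K 'I_10 x ->
  torus K 'I_10 (ec k c2 x) -> torus K 'I_10 (ec k c1 (ec k c2 x)) ->
  torus K 'I_10 (ec k (c1 * c2) x) ->
  ec k c1 (ec k c2 x) = ec k (c1 * c2) x.
Proof.
move=> k6 h1 h2 Tx T2 T1 T12.
apply: (V1_proportional (l := 1) T12 T1) => s; rewrite mul1r.
have e0 := ec_eps_neq0 k6 h2 Tx T2.
rewrite ec_V1 // ec_V1 // raise_scale raise_add ec_V1 ?mulf_neq0 //.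
rewrite scale_factorM mulrA; congr (_ * raise _ _ _ _).
rewrite eps_ec_same //; move: e0; set e := eps k x => e0.
by field; nz.
Qed.

(** The second application is defined by [ec_torus], because the vector it should produce is [V1 x]
    itself. This is the source of dominance of [e_k^c]. *)
Lemma ec_inv k c x : (k < 6)%N -> c != 0 -> torus K 'I_10 x ->
  torus K 'I_10 (ec k c^-1 x) ->
  torus K 'I_10 (ec k c (ec k c^-1 x)) /\ ec k c (ec k c^-1 x) = x.
Proof.
move=> k6 c0 Tx Ti; have ci : c^-1 != 0 by rewrite invr_eq0.
have e0 := ec_eps_neq0 k6 ci Tx Ti.
have ei : eps k (ec k c^-1 x) = eps k x * c by rewrite eps_ec_same // invrK.
have E : vat (V1 x) = fun s => scale_factor k c *
    raise k ((c - 1) / eps k (ec k c^-1 x)) (vat (V1 (ec k c^-1 x))) s.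
  apply/funext => s; rewrite ec_V1 // raise_scale raise_add mulrA -scale_factorM.
  rewrite mulfV // ei.
  rewrite scale_factor1.
  have -> : (c - 1) / (eps k x * c) + (c^-1 - 1) / eps k x = 0 by field; nz.
  by rewrite mul1r raiseE mul0r addr0.
have T1 : torus K 'I_10 (ec k c (ec k c^-1 x)).
  by apply: (ec_torus k6 c0 Ti _ Tx E); rewrite ei mulf_neq0.
split=> //; apply: (V1_proportional (l := 1) Tx T1) => s.
by rewrite mul1r E ec_V1.
Qed.

Lemma ec_one k x : (k < 6)%N -> torus K 'I_10 x -> torus K 'I_10 (ec k 1 x) ->
  ec k 1 x = x.
Proof.
move=> k6 Tx T1; apply: (V1_proportional (l := scale_factor k 1) Tx T1) => s.
by rewrite ec_V1 ?oner_neq0 // raiseE subrr !mul0r addr0.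
Qed.

Lemma ec_comm i j c1 c2 x : (i < 6)%N -> (j < 6)%N -> i != j -> ~~ adjacent i j ->
  c1 != 0 -> c2 != 0 -> torus K 'I_10 x ->
  torus K 'I_10 (ec j c2 x) -> torus K 'I_10 (ec i c1 (ec j c2 x)) ->
  torus K 'I_10 (ec i c1 x) -> torus K 'I_10 (ec j c2 (ec i c1 x)) ->
  ec i c1 (ec j c2 x) = ec j c2 (ec i c1 x).
Proof.
move=> i6 j6 nij ij h1 h2 Tx Tj Tij Ti Tji.
have ji : ~~ adjacent j i by rewrite /adjacent orbC.
apply: (V1_proportional (l := 1) Tji Tij) => s; rewrite mul1r.
rewrite ec_V1 // ec_V1 // [in RHS]ec_V1 // [in RHS]ec_V1 // !raise_scale.
rewrite eps_ec_far // 1?eq_sym // eps_ec_far //.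
by rewrite raise_far // mulrCA.
Qed.

(** Along each composite, the value of [eps] at the node that has just acted and both [rho] are
    known from the initial ones. The [eps] at the other node is then solved from [rho_sum]; the
    denominators reduce to [r + q], [c2 * r + q] and [r + c1 * q]. *)
Lemma ec_braid i j c1 c2 x : (i < 6)%N -> (j < 6)%N -> adjacent i j ->
  c1 != 0 -> c2 != 0 -> torus K 'I_10 x ->
  torus K 'I_10 (ec i c2 x) -> torus K 'I_10 (ec j (c1 * c2) (ec i c2 x)) ->
  torus K 'I_10 (ec i c1 (ec j (c1 * c2) (ec i c2 x))) ->
  torus K 'I_10 (ec j c1 x) -> torus K 'I_10 (ec i (c1 * c2) (ec j c1 x)) ->
  torus K 'I_10 (ec j c2 (ec i (c1 * c2) (ec j c1 x))) ->
  ec i c1 (ec j (c1 * c2) (ec i c2 x)) = ec j c2 (ec i (c1 * c2) (ec j c1 x)).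
Proof.
move=> i6 j6 ij h1 h2 Tx; have h12 : c1 * c2 != 0 by rewrite mulf_neq0.
have ji : adjacent j i by rewrite /adjacent orbC.
set x1 := ec i c2 x; set x2 := ec j _ x1; set x3 := ec i c1 x2.
set y1 := ec j c1 x; set y2 := ec i _ y1; set y3 := ec j c2 y2.
move=> T1 T2 T3 U1 U2 U3.
have E0 := ec_eps_neq0 i6 h2 Tx T1; have F0 := ec_eps_neq0 j6 h1 Tx U1.
have EF := rho_sum i6 j6 Tx ij.
set E := eps i x in E0 EF; set F := eps j x in F0 EF.
set r := rho i j x in EF; set q := rho j i x in EF.
have Ex1 : eps i x1 = E / c2 by exact: eps_ec_same.
have rx1 : rho i j x1 = r by exact: rho_ec_l.
have qx1 : rho j i x1 = q / c2 by exact: rho_ec_r.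
have Fx2 : eps j x2 = eps j x1 / (c1 * c2) by exact: eps_ec_same.
have qx2 : rho j i x2 = q / c2 by rewrite -qx1; exact: rho_ec_l.
have rx2 : rho i j x2 = r / (c1 * c2) by rewrite -rx1; exact: rho_ec_r.
have Fy1 : eps j y1 = F / c1 by exact: eps_ec_same.
have qy1 : rho j i y1 = q by exact: rho_ec_l.
have ry1 : rho i j y1 = r / c1 by exact: rho_ec_r.
have Ey2 : eps i y2 = eps i y1 / (c1 * c2) by exact: eps_ec_same.
have ry2 : rho i j y2 = r / c1 by rewrite -ry1; exact: rho_ec_l.
have qy2 : rho j i y2 = q / (c1 * c2) by rewrite -qy1; exact: rho_ec_r.
have N1 := ec_eps_neq0 j6 h12 T1 T2; have N2 := ec_eps_neq0 i6 h1 T2 T3.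
have := rho_sum i6 j6 T1 ij; have := rho_sum i6 j6 T2 ij.
have := rho_sum i6 j6 U1 ij; have := rho_sum i6 j6 U2 ij.
rewrite rx1 qx1 Ex1 rx2 qx2 Fx2 ry1 qy1 Fy1 ry2 qy2 Ey2 => sy2 sy1 sx2 sx1.
have N3 := ec_eps_neq0 i6 h12 U1 U2; have N4 := ec_eps_neq0 j6 h2 U2 U3.
(* [l] is the ratio of the scalars accumulated on the two sides; it does not have to be
   evaluated. *)
apply: (V1_proportional (l :=
  scale_factor i c1 * scale_factor j (c1 * c2) * scale_factor i c2
  / (scale_factor j c2 * scale_factor i (c1 * c2) * scale_factor j c1)) U3 T3)
  => s.
rewrite /x3 ec_V1 // /x2 ec_V1 // -/x2 /x1 ec_V1 // -/x1 !raise_scale.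
rewrite /y3 ec_V1 // /y2 ec_V1 // -/y2 /y1 ec_V1 // -/y1 !raise_scale.
set fx1 := eps j x1 in N1 Fx2 sx1 sx2 *; set ex2 := eps i x2 in N2 sx2 *.
set ey1 := eps i y1 in N3 Ey2 sy1 sy2 *; set fy2 := eps j y2 in N4 sy2 *.
have c12 : c1 * c2 != 0 by [].
have Efx1 : fx1 = (c2 * r + q) / E.
  by apply: (mulfI (mulf_neq0 E0 (invr_neq0 h2))); rewrite -sx1; field; nz.
have u0 : c2 * r + q != 0 by apply: (neq0_clear N1 E0); rewrite Efx1 divfK.
have Eex2 : ex2 = (r + c1 * q) / fx1.
  by apply: (mulIf (mulf_neq0 N1 (invr_neq0 h12))); rewrite -sx2; field; nz.
have v0 : r + c1 * q != 0 by apply: (neq0_clear N2 N1); rewrite Eex2 divfK.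
have Eey1 : ey1 = (r + c1 * q) / F.
  by apply: (mulIf (mulf_neq0 F0 (invr_neq0 h1))); rewrite -sy1; field; nz.
have Efy2 : fy2 = (c2 * r + q) / ey1.
  by apply: (mulfI (mulf_neq0 N3 (invr_neq0 h12))); rewrite -sy2; field; nz.
have EF' : F = (r + q) / E by rewrite EF mulrAC mulfV // mul1r.
have rq0 : r + q != 0 by rewrite EF mulf_neq0.
(* The exponents of the other composite, taken at [x], [y1] and [y2]. The four remaining equations
   become rational identities in [E], [r], [q], [c1] and [c2]. *)
rewrite (raise_braid (a' := (c1 - 1) / F) (s' := (c1 * c2 - 1) / ey1)
  (d' := (c2 - 1) / fy2) _ ij).
- set w := raise _ _ _; rewrite !mulrA; congr (_ * _).
  have n k c : c != 0 -> scale_factor k c != 0 :> K by exact: scale_factor_neq0.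
  by field; rewrite !n.
- by rewrite Eex2 Eey1 Efx1 EF' -/E; field; nz.
- by rewrite Efy2 Eey1 Efx1 EF' -/E; field; nz.
- by rewrite Eey1 Eex2 Efx1 EF' -/E; field; nz.
by rewrite Efy2 Eey1 Efx1 EF' -/E; field; nz.
Qed.

Definition gam k (x : aff K 'I_10) : K :=
  if k is 0 then gamma0_coord x else gamma_coord k x.

(** The product of the [p i] to the powers given by column [k] of the Cartan matrix, with [p 0 = 1]
    left out. The numbers [degmin i] are 1, 1, 2, 2, 1, 1, the coefficients of the null root, so the
    scalar of [e_0^c] drops out of the full product. *)
Definition gam_p (p : nat -> K) k : K :=
  match k with
  | 0 => 1 / p 2
  | 1 => p 1 ^+ 2 / p 2
  | 2 => p 2 ^+ 2 / (p 3 * p 1)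
  | 3 => p 3 ^+ 2 / (p 2 * p 4 * p 5)
  | 4 => p 4 ^+ 2 / p 3
  | _ => p 5 ^+ 2 / p 3
  end%N.

Lemma gamE k x : (k < 6)%N -> torus K 'I_10 x ->
  gam k x = gam_p (fun j => p_coord j x) k.
Proof.
move=> k6; move: x; dcoords.
case: k k6 => [|[|[|[|[|[|//]]]]]] _; cbn [gam gam_p];
  rewrite /gamma0_coord /gamma_coord /p_coord !with_coords_vec;
  cbv beta iota zeta; field; nz.
Qed.

Definition cartan (i j : nat) : int :=
  if i == j then 2 else if adjacent i j then -1 else 0.

Lemma cartanE (i j : 'I_6) : D5_cartan i j = cartan i j.
Proof. by rewrite /D5_cartan /cartan -val_eqE. Qed.

Lemma gam_p_scale k j c p p' : (k < 6)%N -> (j < 6)%N -> c != 0 ->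
  (forall i, p i != 0) ->
  (forall i, (i < 6)%N -> p' i = scale_factor k c ^+ degmin i *
    ((if k == i then c else 1) * p i)) ->
  gam_p p' j = c ^ cartan k j * gam_p p j.
Proof.
move=> k6 j6 c0 p0 pE.
have := p0 1%N; have := p0 2%N; have := p0 3%N; have := p0 4%N; have := p0 5%N.
move=> h5 h4 h3 h2 h1.
have -> : gam_p p' j = gam_p (fun i => scale_factor k c ^+ degmin i *
    ((if k == i then c else 1) * p i)) j.
  by move: j j6; case=> [|[|[|[|[|[|//]]]]]] _; rewrite /gam_p !pE.
case: k k6 {pE} => [|[|[|[|[|[|//]]]]]] _; case: j j6 => [|[|[|[|[|[|//]]]]]] _.
all: rewrite /gam_p /cartan /= ?expr0z ?exprN1.
all: by field; nz.
Qed.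

Lemma gam_ec k j c x : (k < 6)%N -> (j < 6)%N -> c != 0 ->
  torus K 'I_10 x -> torus K 'I_10 (ec k c x) ->
  gam j (ec k c x) = c ^ cartan k j * gam j x.
Proof.
move=> k6 j6 c0 Tx Te; rewrite !gamE //.
apply: gam_p_scale => // i; first exact: p_coord_neq0.
exact: p_coord_ec.
Qed.
End SpinAction.

(** * Domains of the structure maps and their genericity *)

Section Crystal.
Variable K : numFieldType.

(* For [k = 0], the structure is only defined where [sigma_bar] is.          *)
Definition structure_dom k (x : aff K 'I_10) : Prop :=
  if k is 0 then sigma_cond x else True.

Definition ec_dom k c (x : aff K 'I_10) : Prop :=
  structure_dom k x /\ ec_cond k c x.

Lemma ec_dom_torus k c x : (k < 6)%N -> c != 0 -> torus K 'I_10 x ->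
  ec_dom k c x -> torus K 'I_10 (ec k c x).
Proof. by move=> k6 c0 Tx [_ h]; apply/ec_torusP. Qed.

Lemma V1_eE (k : 'I_6) c x v : c != 0 -> torus K 'I_10 x ->
  V1_e k c (V1 x) v <-> ec_dom k c x /\ v = V1 (ec k c x).
Proof.
move=> c0 Tx; rewrite /V1_e /ec_dom; case: k => [[|k] hk]; cbn [val eqn].
  rewrite [0%N == 0%N]eqxx e0E // sigma_torusP // ec_torusP //.
rewrite /chart_map; split.
  move=> [y [Ty Te /(V1_inj Tx Ty) E ->]]; subst y; split=> //; split=> //.
  by apply/ec_torusP.
by move=> [[_ /(ec_torusP hk c0 Tx) Te] ->]; exists x.
Qed.

Lemma V1_gammaE (k : 'I_6) x b : torus K 'I_10 x ->
  V1_gamma k (V1 x) b <-> structure_dom k x /\ b = gam k x.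
Proof.
move=> Tx; rewrite /V1_gamma; case: k => [[|k] hk]; cbn [val eqn].
  by rewrite [0%N == 0%N]eqxx gamma0E // sigma_torusP.
split; first by move=> [y [Ty /(V1_inj Tx Ty) E ->]]; subst y.
by move=> [_ ->]; exists x.
Qed.

Lemma V1_epsilonE (k : 'I_6) x b : torus K 'I_10 x ->
  V1_epsilon k (V1 x) b <-> structure_dom k x /\ b = eps k x.
Proof.
move=> Tx; rewrite /V1_epsilon; case: k => [[|k] hk]; cbn [val eqn].
  by rewrite [0%N == 0%N]eqxx epsilon0E // sigma_torusP.
split; first by move=> [y [Ty /(V1_inj Tx Ty) E ->]]; subst y.
by move=> [_ ->]; exists x.
Qed.

Section Regularity.
Variables (J : finType) (D : aff K J -> Prop).
Variables (c : aff K J -> K) (x : aff K J -> aff K 'I_10).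
Hypotheses (rc : ratfun D c) (rx : ratmap D x).
Hypothesis DT : forall u, D u -> torus K 'I_10 (x u).

Let rxi i : ratfun D (fun u => x u i).
Proof. exact: rx. Qed.

Let x0 u i : D u -> x u i != 0.
Proof. by move=> /DT. Qed.

Ltac regular := repeat first
  [ exact: ratfun_cst | exact: rc | exact: rxi
  | apply: ratfunD | apply: ratfunN | apply: ratfunX
  | apply: ratfunM | apply: ratfunV ].

Lemma structure_dom_popen k : popen D (fun u => structure_dom k (x u)).
Proof.
case: k => [|k]; last exact: popenT.
rewrite /structure_dom /sigma_cond /with_coords.
apply: popenI4; apply: popen_neq0; regular.
all: by move=> u Du; rewrite ?mulf_neq0 ?x0.
Qed.

Lemma ec_cond_popen k : popen D (fun u => ec_cond k (c u) (x u)).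
Proof.
rewrite /ec_cond /with_coords; case: k => [|[|[|[|[|[|k]]]]]];
  cbv beta iota zeta; try exact: popenT.
- by apply: popenI5; apply: popen_neq0; regular => u Du; rewrite ?mulf_neq0 ?x0.
- by apply: popenI; apply: popen_neq0; regular.
- by apply: popenI3; apply: popen_neq0; regular.
- by apply: popenI; apply: popen_neq0; regular.
by apply: popenI; apply: popen_neq0; regular.
Qed.

Lemma ec_dom_popen k : popen D (fun u => ec_dom k (c u) (x u)).
Proof.
by apply: popenI; [exact: structure_dom_popen | exact: ec_cond_popen].
Qed.

Hypothesis c0 : forall u, D u -> c u != 0.

Lemma ec_ratmap k : (k < 6)%N -> (forall u, D u -> ec_cond k (c u) (x u)) ->
  ratmap D (fun u => ec k (c u) (x u)).
Proof.
case: k => [|[|[|[|[|[|//]]]]]] _; rewrite /ec_cond /ec /e0_coord /A_coord /B_coord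
  /C_coord /e_coord /with_coords /= => h; apply: ratmap_vec10; split; regular.
all: move=> u Du; have := h u Du => hu.
all: repeat match goal with
  | H : _ /\ _ |- _ => destruct H
  | H : [/\ _, _ & _] |- _ => destruct H
  | H : [/\ _, _, _, _ & _] |- _ => destruct H
  end.
all: repeat first [ assumption | exact: x0 | exact: c0 | apply: mulf_neq0
  | apply: invr_neq0 | apply: expf_neq0 ].
Qed.
End Regularity.

(* A positive real which dominates every small multiple of [c].              *)
Let big (c : K) : K := 1 + `|c| * 4.

Let big_gt0 c : 0 < big c.
Proof. by rewrite ltr_wpDr ?mulr_ge0. Qed.

(** Here [c] may be any complex number, so absolute values are compared: a zero would force
    [big c + p] to be at most [4 * |c|]. *)
Let big_neq0 c m p : 0 <= m -> m <= 4 -> 0 <= p -> c * m + (big c + p) != 0.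
Proof.
move=> m0 m4 p0; rewrite addrC addr_eq0; apply/negP => /eqP e.
have bp : 0 < big c + p by rewrite ltr_wpDr.
have : `|big c + p| = `|c| * m by rewrite e normrN normrM (ger0_norm m0).
rewrite gtr0_norm // => {}e.
have h : big c + p <= `|c| * 4 by rewrite e ler_wpM2l.
have : `|c| * 4 < big c + p by rewrite /big -addrA ltr_pwDl // lerDl.
by rewrite (le_gtF h).
Qed.

Lemma generic_ec_dom k c : (k < 6)%N -> c != 0 -> generic (ec_dom k c).
Proof.
move=> k6 c0; pose t := big c; have t0 : t != 0 by rewrite gt_eqF ?big_gt0.
have g x : torus K 'I_10 x -> ec_dom k c x -> generic (ec_dom k c).
  move=> Tx; apply: popen_generic Tx.
  apply: (ec_dom_popen (ratfun_cst _ c)) => // j; exact: ratfun_var.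
have key a m p : (m <= 4)%N -> a = c * m%:R + (t + p%:R) -> a != 0.
  by move=> m4 ->; apply: big_neq0; rewrite ?ler_nat ?ler0n.
have nat0 (a : K) n : a = n.+1%:R -> a != 0 by move=> ->; rewrite pnatr_eq0.
case: k k6 g => [|[|[|[|[|[|//]]]]]] _ g.
(* With [x42 = t^-1] the term [x22 * x21 / x42] is [t]. The condition for [x42'] becomes
   [4 * c + t], which is where the bound 4 in [big] comes from. *)
- apply: (g (vec10 [:: t^-1; 1; 1; 1; 1; 1; 1; 1; 1; 1])).
    by apply/torus_vec10P; rewrite invr_eq0 !oner_neq0.
  rewrite /ec_dom /structure_dom /sigma_cond /ec_cond !with_coords_vec.
  cbv beta iota zeta; split; split.
  + by apply: (nat0 _ 2); field.
  + by apply: (nat0 _ 1%N); field.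
  + by apply: (key _ 0%N 1%N) => //; field; nz.
  + by apply: (key _ 0%N 3) => //; field; nz.
  + by apply: (key _ 0%N 4) => //; field; nz.
  + by apply: (key _ 4 0%N) => //; field; nz.
  + by apply: (key _ 2 2) => //; field; nz.
  + by apply: (key _ 1%N 3) => //; field; nz.
  by apply: (key _ 3 1%N) => //; field; nz.
- apply: (g (vec10 [:: 1; 1; 1; 1; 1; 1; 1; 1; 1; 1])); last by [].
  by apply/torus_vec10P; rewrite !oner_neq0.
- apply: (g (vec10 [:: 1; 1; 1; 1; 1; 1; t; 1; 1; 1])).
    by apply/torus_vec10P; rewrite !oner_neq0.
  rewrite /ec_dom /structure_dom /ec_cond !with_coords_vec; split=> //; split.
    by apply: (key _ 1%N 0%N) => //; ring.
  by apply: (key _ 0%N 1%N) => //; ring.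
- apply: (g (vec10 [:: 1; 1; 1; 1; 1; t; 1; 1; 1; 1])).
    by apply/torus_vec10P; rewrite !oner_neq0.
  rewrite /ec_dom /structure_dom /ec_cond !with_coords_vec; split=> //; split.
  + by apply: (key _ 1%N 1%N) => //; ring.
  + by apply: (key _ 0%N 2) => //; ring.
  by apply: (key _ 2 0%N) => //; ring.
- apply: (g (vec10 [:: 1; t; 1; 1; 1; 1; 1; 1; 1; 1])).
    by apply/torus_vec10P; rewrite !oner_neq0.
  rewrite /ec_dom /structure_dom /ec_cond !with_coords_vec; split=> //; split.
    by apply: (key _ 1%N 0%N) => //; ring.
  by apply: (key _ 0%N 1%N) => //; ring.
apply: (g (vec10 [:: 1; 1; 1; 1; 1; 1; 1; 1; t; 1])).
  by apply/torus_vec10P; rewrite !oner_neq0.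
rewrite /ec_dom /structure_dom /ec_cond !with_coords_vec; split=> //; split.
  by apply: (key _ 1%N 0%N) => //; ring.
by apply: (key _ 0%N 1%N) => //; ring.
Qed.

Lemma generic_structure_dom k : (k < 6)%N -> generic (structure_dom k).
Proof.
move=> k6; apply: generic_imp (generic_ec_dom k6 (oner_neq0 K)) => x _.
by case.
Qed.

(** Lets composites be treated one factor at a time: a generic condition stays generic after
    [e_k^c], which is dominant as [ec k c^-1 y] is a preimage of a generic [y]. *)
Lemma generic_ec k c (P : aff K 'I_10 -> Prop) : (k < 6)%N -> c != 0 ->
  generic P -> generic (fun x => ec_dom k c x /\ P (ec k c x)).
Proof.
move=> k6 c0; apply: generic_comp.
- by apply: (ec_dom_popen (ratfun_cst _ c)) => // j; exact: ratfun_var.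
- apply: (ec_ratmap (c := fun=> c) (ratfun_cst _ c)) => //.
  + by move=> j; exact: ratfun_var.
  + by move=> x [].
  by move=> x [_ []].
- by move=> x; exact: ec_dom_torus.
have ci : c^-1 != 0 by rewrite invr_eq0.
apply: generic_imp (generic_ec_dom k6 ci) => y Ty dy.
have Ti := ec_dom_torus k6 ci Ty dy.
have [T1 E] := ec_inv k6 c0 Ty Ti.
exists (ec k c^-1 y); split=> //; split; last by apply/(ec_torusP k6 c0 Ti).
(* For [k = 0] the preimage must also lie in the domain of [sigma_bar]; this is inherited from [y],
   since raising by [e_0] preserves [sigma_cond]. *)
case: k k6 dy Ti {T1 E} => // k6 [dy _] Ti.
by apply: (sigma_cond_raise Ty Ti _ (ec_V1 k6 ci Ty Ti) dy); rewrite scale_factor_neq0.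
Qed.

End Crystal.

(** * The axioms of a geometric crystal *)

Section GeometricCrystal.
Variable K : numFieldType.
Implicit Types (i j k : 'I_6) (c : K).

Let C : chart (V1_var K) (@V1 K) (@V1_inv K) := (V1_chart_irreducible K).1.

Lemma ratfun_gam (k : nat) : (k < 6)%N -> ratfun (torus K 'I_10) (gam k).
Proof.
case: k => [|[|[|[|[|[|//]]]]]] _;
  rewrite /gam /gamma0_coord /gamma_coord /with_coords; rat => x Tx;
  by rewrite !mulf_neq0.
Qed.

Lemma ratfun_eps (k : nat) : (k < 6)%N -> ratfun (torus K 'I_10) (eps k).
Proof.
case: k => [|[|[|[|[|[|//]]]]]] _;
  rewrite /eps /epsilon0_coord /epsilon_coord /A_coord /B_coord /C_coord
    /with_coords; by rat => x Tx; rewrite ?mulf_neq0 ?expf_neq0.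
Qed.

Lemma V1_e_rational k :
  rational_map (Gm_times (V1_var K)) (V1_var K) (uncurried (@V1_e K k)).
Proof.
pose P u := ec_dom k (gm_part u) (@aff_part K _ u).
have rc D : ratfun D (@gm_part K 'I_10) by exact: ratfun_var.
have rx D : ratmap D (@aff_part K 'I_10) by exact: ratmap_aff_part.
apply: (chart_rational_map (ochart_chart C) (P := P)
  (h := fun u => V1 (ec k (gm_part u) (aff_part u)))).
- by apply: ec_dom_popen => // u /torus_optionE[].
- have [x Tx dx] := generic_ex (generic_ec_dom (ltn_ord k) (oner_neq0 K)).
  exists (apair 1 x).
    by apply/torus_optionE; rewrite gm_part_pair aff_part_pair oner_neq0.
  by rewrite /P gm_part_pair aff_part_pair.
- move=> s; apply: (ratfun_comp _ _ (chart_rat C s)).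
    apply: (ec_ratmap (rc _) (rx _)) =>
      [u [/torus_optionE[]]//|u [/torus_optionE[]]//||u [_ []]//].
    exact: ltn_ord.
  move=> u [/torus_optionE[c0 Tx] Pu]; exact: ec_dom_torus (ltn_ord k) c0 Tx Pu.
- move=> u /torus_optionE[c0 Tx] Pu; apply: (chart_in C).
  exact: ec_dom_torus (ltn_ord k) c0 Tx Pu.
move=> u w /torus_optionE[c0 Tx].
by rewrite /uncurried /ochart gm_part_pair aff_part_pair V1_eE.
Qed.

Lemma V1_function_rational (F : aff K spin -> K -> Prop) k (f : aff K 'I_10 -> K) :
  ratfun (torus K 'I_10) f ->
  (forall x b, torus K 'I_10 x -> F (V1 x) b <-> structure_dom k x /\ b = f x) ->
  rational_function (V1_var K) F.
Proof.
move=> rf FE; apply: (chart_rational_map C (P := structure_dom k)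
  (h := fun x => [ffun=> f x])).
- by apply: (structure_dom_popen (x := fun x => x)) => // j; exact: ratfun_var.
- exact: generic_ex (generic_structure_dom _ (ltn_ord k)).
- move=> []; apply: (@eq_ratfun _ _ _ f) => [x _|]; first by rewrite ffunE.
  by apply: sub_ratfun rf => x [].
- by [].
move=> x w Tx; rewrite FE //; split=> -[dx E]; split=> //.
  by apply/ffunP => -[]; rewrite ffunE.
by rewrite E ffunE.
Qed.

Lemma V1_geometric_crystal :
  geometric_crystal D5_cartan (V1_var K)
    (@V1_e K) (@V1_gamma K) (@V1_epsilon K).
Proof.
split.
- exact: (V1_chart_irreducible K).2.
- exact: V1_e_rational.
- move=> i; apply: (chart_ratmap_eq C).
  apply: generic_imp (generic_ec_dom (ltn_ord i) (oner_neq0 K)) => x Tx dx.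
  have T1 := ec_dom_torus (ltn_ord i) (oner_neq0 K) Tx dx.
  exists (V1 x); split=> //; apply/V1_eE => //; first exact: oner_neq0.
  by rewrite ec_one.
- move=> i c1 c2 h1 h2; apply: (chart_ratmap_eq C).
  have h12 : c1 * c2 != 0 by rewrite mulf_neq0.
  have i6 := ltn_ord i.
  apply: generic_imp (genericI (generic_ec_dom i6 h12)
    (generic_ec i6 h2 (generic_ec_dom i6 h1))) => x Tx [d12 [d2 d1]].
  have T2 := ec_dom_torus i6 h2 Tx d2.
  exists (V1 (ec i (c1 * c2) x)); split; last by apply/V1_eE.
  exists (V1 (ec i c2 x)); first by apply/V1_eE.
  apply/V1_eE => //; split=> //; rewrite ec_mul //; exact: ec_dom_torus.
- move=> i; apply: (V1_function_rational (k := i) (ratfun_gam (ltn_ord i))).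
  by move=> x b; exact: V1_gammaE.
- move=> i; apply: (V1_function_rational (k := i) (ratfun_eps (ltn_ord i))).
  by move=> x b; exact: V1_epsilonE.
- move=> i v Xv; split=> //.
  (* The identity extends [e_i^1] to all of [V1_var]. That the whole space is open is shown by
     taking all polynomials, among them 1, as equations of the empty set. *)
  exists setT, (fun s => pvar K s), (fun=> 1); split=> //.
    exists setT; apply/seteqP; split=> u /= h; first by case: h.
    by have := h 1 I; rewrite peval1 => /eqP; rewrite oner_eq0.
  move=> u Xu _.
  have E : rat_eval (fun s => pvar K s) (fun=> 1) u = u.
    by apply/ffunP => s; rewrite ffunE peval1 peval_var divr1.
  rewrite E; split=> // [s|w]; first by rewrite peval1 oner_neq0.
  have [x Tx ->] := chart_onto C Xu.
  move=> /V1_eE-/(_ (oner_neq0 K) Tx)[dx ->].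
  by rewrite ec_one //; apply: ec_dom_torus => //; exact: oner_neq0.
- move=> i; apply: (ratdom_slice_open_dense C
    (generic_ec_dom (ltn_ord i) (oner_neq0 K))).
  move=> x Tx dx; apply: (ratmap_regular (V1_e_rational i) (w := V1 (ec i 1 x))).
    split; rewrite ?gm_part_pair ?oner_neq0 // aff_part_pair; exact: (chart_in C).
  rewrite /uncurried gm_part_pair aff_part_pair.
  by apply/V1_eE => //; exact: oner_neq0.
- move=> i j c c0; apply: (chart_ratmap_eq C).
  have i6 := ltn_ord i; have j6 := ltn_ord j.
  apply: generic_imp (genericI (generic_structure_dom K j6)
    (generic_ec i6 c0 (generic_structure_dom K j6))) => x Tx [dj [di dij]].
  have Ti := ec_dom_torus i6 c0 Tx di.
  exists (gam j (ec i c x)); split.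
    exists (V1 (ec i c x)); first by apply/V1_eE.
    by apply/V1_gammaE.
  exists (gam j x); first by apply/V1_gammaE.
  by rewrite gam_ec // cartanE.
- move=> i j c1 c2 h1 h2 aij _; apply: (chart_ratmap_eq C).
  have i6 := ltn_ord i; have j6 := ltn_ord j.
  have [nij ij] : val i != val j /\ ~~ adjacent i j.
    move: aij; rewrite cartanE /cartan; case: eqP => // _.
    by case: (adjacent i j).
  apply: generic_imp (genericI (generic_ec j6 h2 (generic_ec_dom i6 h1))
    (generic_ec i6 h1 (generic_ec_dom j6 h2))) => x Tx [[dj dij] [di dji]].
  have Ti := ec_dom_torus i6 h1 Tx di; have Tj := ec_dom_torus j6 h2 Tx dj.
  have Tij := ec_dom_torus i6 h1 Tj dij; have Tji := ec_dom_torus j6 h2 Ti dji.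
  exists (V1 (ec i c1 (ec j c2 x))); split.
    by exists (V1 (ec j c2 x)); apply/V1_eE.
  exists (V1 (ec i c1 x)); apply/V1_eE => //; split=> //.
  by rewrite ec_comm.
- move=> i j c1 c2 h1 h2 aij _; apply: (chart_ratmap_eq C).
  have i6 := ltn_ord i; have j6 := ltn_ord j.
  have h12 : c1 * c2 != 0 by rewrite mulf_neq0.
  have ij : adjacent i j.
    move: aij; rewrite cartanE /cartan; case: eqP => // _.
    by case: (adjacent i j).
  apply: generic_imp (genericI
      (generic_ec i6 h2 (generic_ec j6 h12 (generic_ec_dom i6 h1)))
      (generic_ec j6 h1 (generic_ec i6 h12 (generic_ec_dom j6 h2)))).
  move=> x Tx [[d1 [d2 d3]] [b1 [b2 b3]]].
  have T1 := ec_dom_torus i6 h2 Tx d1; have T2 := ec_dom_torus j6 h12 T1 d2.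
  have T3 := ec_dom_torus i6 h1 T2 d3.
  have U1 := ec_dom_torus j6 h1 Tx b1; have U2 := ec_dom_torus i6 h12 U1 b2.
  have U3 := ec_dom_torus j6 h2 U2 b3.
  exists (V1 (ec i c1 (ec j (c1 * c2) (ec i c2 x)))); split.
    exists (V1 (ec j (c1 * c2) (ec i c2 x))); last by apply/V1_eE.
    by exists (V1 (ec i c2 x)); apply/V1_eE.
  rewrite ec_braid //.
  exists (V1 (ec i (c1 * c2) (ec j c1 x))); last by apply/V1_eE.
  by exists (V1 (ec j c1 x)); apply/V1_eE.
- move=> i c c0; apply: (chart_ratmap_eq C); have i6 := ltn_ord i.
  apply: generic_imp (genericI (generic_structure_dom K i6)
    (generic_ec i6 c0 (generic_structure_dom K i6))) => x Tx [dj [di dij]].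
  have Ti := ec_dom_torus i6 c0 Tx di.
  exists (eps i (ec i c x)); split.
    exists (V1 (ec i c x)); first by apply/V1_eE.
    by apply/V1_epsilonE.
  exists (eps i x); first by apply/V1_epsilonE.
  by rewrite eps_ec_same // mulrC.
move=> i j c c0 aij _; apply: (chart_ratmap_eq C).
have i6 := ltn_ord i; have j6 := ltn_ord j.
have [nij ij] : val i != val j /\ ~~ adjacent i j.
  move: aij; rewrite cartanE /cartan; case: eqP => // _.
  by case: (adjacent i j).
apply: generic_imp (genericI (generic_structure_dom K i6)
  (generic_ec j6 c0 (generic_structure_dom K i6))) => x Tx [dj [di dij]].
have Ti := ec_dom_torus j6 c0 Tx di.
exists (eps i x); split; last by apply/V1_epsilonE.
exists (V1 (ec j c x)); first by apply/V1_eE.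
apply/V1_epsilonE => //; split=> //.
by rewrite eps_ec_far // 1?eq_sym // /adjacent orbC.
Qed.

End GeometricCrystal.

(** * Positivity *)

Section Positivity.
Variable K : numFieldType.

Lemma positive_polyP n (p : {mpoly K[n]}) :
  positive_poly p <-> p != 0 /\ forall m, 0 <= p@_m.
Proof.
split=> -[p0 h]; split=> // m.
  by have [/h/ltW//|/memN_msupp_eq0->] := boolP (m \in msupp p).
by rewrite lt_def h andbT -mcoeff_msupp.
Qed.

Lemma positive_polyM n (p q : {mpoly K[n]}) :
  positive_poly p -> positive_poly q -> positive_poly (p * q).
Proof.
move=> /positive_polyP[p0 hp] /positive_polyP[q0 hq]; apply/positive_polyP.
split=> [|m]; first exact: mulf_neq0.
by rewrite mcoeffM; apply: sumr_ge0 => k _; exact: mulr_ge0.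
Qed.

(** The value at the all-ones point is the sum of the coefficients. That point thus witnesses at
    once that finitely many positive polynomials are generically nonzero. *)
Lemma positive_poly_peval1 (J : finType) (p : {mpoly K[#|J|]}) :
  positive_poly p -> peval p [ffun=> 1] != 0.
Proof.
move=> [p0 hp]; rewrite pevalE.
have E m : p@_m * \prod_i ([ffun=> 1] : aff K J) (enum_val i) ^+ m i = p@_m.
  by rewrite big1 ?mulr1 // => i _; rewrite ffunE expr1n.
under eq_bigr do rewrite E.
rewrite (bigD1_seq (mlead p)) ?mlead_supp ?msupp_uniq //= gt_eqF // ltr_wpDr //.
  by rewrite big_seq_cond; apply: sumr_ge0 => m /andP[/hp/ltW].
by rewrite hp ?mlead_supp.
Qed.

(** No cancellation is possible: the leading monomial of [p] keeps a positive coefficient in the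
    sum. *)
Lemma positive_polyD n (p q : {mpoly K[n]}) :
  positive_poly p -> positive_poly q -> positive_poly (p + q).
Proof.
move=> [p0 hp'] /positive_polyP[q0 hq].
have /positive_polyP[_ hp] : positive_poly p by [].
apply/positive_polyP; split=> [|m]; last by rewrite mcoeffD addr_ge0.
have m1 : mlead p \in msupp p by rewrite mlead_supp.
apply/eqP => /(congr1 (fun r => r@_(mlead p))); rewrite mcoeffD mcoeff0 => /eqP.
by rewrite gt_eqF // ltr_pwDl // hp'.
Qed.

Lemma positive_poly1 n : @positive_poly K n 1.
Proof.
apply/positive_polyP; split=> [|m]; first exact: oner_neq0.
by rewrite mcoeff1 ler0n.
Qed.

Lemma positive_pvar (J : finType) (j : J) : positive_poly (pvar K j).
Proof.
apply/positive_polyP; split=> [|m].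
  apply/eqP => /(congr1 (fun r => r@_U_(enum_rank j))) /eqP.
  by rewrite mcoeffXU eqxx mcoeff0 oner_eq0.
by rewrite /pvar mcoeffX ler0n.
Qed.

(** Positive formulas can still hit zero denominators at complex points, where the total division of
    the field disagrees with formal simplification. The polynomial [h] records where the two agree
    and nothing vanishes; [n] is kept nonzero to allow inversion. *)
Definition posfun (J : finType) (f : aff K J -> K) : Prop :=
  exists n d h : {mpoly K[#|J|]},
    [/\ positive_poly n, positive_poly d, positive_poly h &
     forall x, torus K J x -> peval h x != 0 ->
       [/\ peval n x != 0, peval d x != 0 & f x = peval n x / peval d x]].

Section PosfunClosure.
Variable J : finType.
Implicit Types f g : aff K J -> K.

Lemma posfun_var j : posfun (fun x : aff K J => x j).
Proof.
exists (pvar K j), 1, 1; split; [exact: positive_pvar|exact: positive_poly1..|].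
by move=> x Tx _; rewrite peval_var peval1 divr1 oner_neq0.
Qed.

Lemma posfun1 : posfun (fun _ : aff K J => 1).
Proof.
exists 1, 1, 1; split; [exact: positive_poly1..|].
by move=> x Tx _; rewrite peval1 divr1 oner_neq0.
Qed.

Lemma posfunM f g : posfun f -> posfun g -> posfun (fun x => f x * g x).
Proof.
move=> [n [d [h [Pn Pd Ph H]]]] [n' [d' [h' [Pn' Pd' Ph' H']]]].
exists (n * n'), (d * d'), (h * h'); split; [exact: positive_polyM..|].
move=> x Tx; rewrite !pevalM mulf_eq0 negb_or => /andP[hx hx'].
have [? ? ->] := H x Tx hx; have [? ? ->] := H' x Tx hx'.
by rewrite mulf_div; split=> //; exact: mulf_neq0.
Qed.

Lemma posfunV f : posfun f -> posfun (fun x => (f x)^-1).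
Proof.
move=> [n [d [h [Pn Pd Ph H]]]]; exists d, n, h; split=> // x Tx /(H x Tx)[? ? ->].
by split=> //; rewrite invf_div.
Qed.

Lemma posfunD f g : posfun f -> posfun g -> posfun (fun x => f x + g x).
Proof.
move=> [n [d [h [Pn Pd Ph H]]]] [n' [d' [h' [Pn' Pd' Ph' H']]]].
have P : positive_poly (n * d' + n' * d).
  by apply: positive_polyD; exact: positive_polyM.
(* The new numerator enters the guard, since a sum of nonzero complex values may vanish. *)
exists (n * d' + n' * d), (d * d'), (h * h' * (n * d' + n' * d)); split=> //.
- exact: positive_polyM.
- by apply: positive_polyM => //; exact: positive_polyM.
move=> x Tx; rewrite pevalM [peval (h * h') x]pevalM mulf_eq0 negb_or.
move=> /andP[]; rewrite mulf_eq0 negb_or => /andP[hx hx'] s0.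
have [? ? ->] := H x Tx hx; have [? ? ->] := H' x Tx hx'.
by split=> //; rewrite ?pevalD !pevalM ?mulf_neq0 // addf_div.
Qed.

Lemma posfunX f n : posfun f -> posfun (fun x => f x ^+ n).
Proof.
move=> pf; elim: n => [|n IH].
  by under eq_fun do rewrite expr0; exact: posfun1.
by under eq_fun do rewrite exprS; exact: posfunM.
Qed.

Lemma eq_posfun f g : f =1 g -> posfun f -> posfun g.
Proof. by move=> /funext ->. Qed.

End PosfunClosure.

Lemma posfun_positive_map J J' (F : aff K J -> aff K J' -> Prop)
    (P : aff K J -> Prop) (f : aff K J -> aff K J') :
  generic P -> (forall x, torus K J x -> P x -> F x (f x)) ->
  (forall j, posfun (fun x => f x j)) ->
  positive_map (torus K J) F.
Proof.
move=> gP FP /fin_all_exists[n /fin_all_exists[d /fin_all_exists[h H]]].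
exists n, d; split=> [j|]; first by have [] := H j.
apply: (chart_ratmap_eq (@chart_id K J)).
have gh : generic (fun x => forall j, peval (h j) x != 0).
  apply: (@popen_generic _ _ _ [ffun=> 1]).
  - by apply: popen_all => j; apply: popen_neq0; exact: ratfun_peval.
  - by move=> j; rewrite ffunE oner_neq0.
  by move=> j; have [_ _ /positive_poly_peval1] := H j.
apply: generic_imp (genericI gP gh) => x Tx [Px hx].
exists (f x); split; first exact: FP.
split=> [j|].
  by have [_ _ _ /(_ x Tx (hx j))[]] := H j.
by apply/ffunP => j; rewrite ffunE; have [_ _ _ /(_ x Tx (hx j))[_ _ ->]] := H j.
Qed.

Ltac positive := repeat first
  [ exact: posfun1 | exact: posfun_var | apply: posfunD | apply: posfunX
  | apply: posfunM | apply: posfunV ].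

Lemma posfun_gam k : (k < 6)%N -> posfun (gam k : aff K 'I_10 -> K).
Proof.
case: k => [|[|[|[|[|[|//]]]]]] _;
  by rewrite /gam /gamma0_coord /gamma_coord /with_coords; positive.
Qed.

Lemma posfun_eps k : (k < 6)%N -> posfun (eps k : aff K 'I_10 -> K).
Proof.
case: k => [|[|[|[|[|[|//]]]]]] _;
  by rewrite /eps /epsilon0_coord /epsilon_coord /A_coord /B_coord /C_coord
    /with_coords; positive.
Qed.

Lemma posfun_vec10 (J : finType) (a b c d e f g h i j : aff K J -> K) :
  [/\ posfun a, posfun b, posfun c, posfun d & posfun e] ->
  [/\ posfun f, posfun g, posfun h, posfun i & posfun j] ->
  forall m, posfun (fun v =>
    vec10 [:: a v; b v; c v; d v; e v; f v; g v; h v; i v; j v] m).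
Proof.
move=> [ra rb rc rd re] [rf rg rh ri rj] [m hm].
under eq_fun do rewrite ffunE.
by do 10![case: m hm => [|m] hm //=].
Qed.

Lemma posfun_ec k m : (k < 6)%N -> posfun (fun u : aff K (option 'I_10) =>
  ec k (gm_part u) (aff_part u) m).
Proof.
have pc : posfun (@gm_part K 'I_10) by exact: posfun_var.
have px i : posfun (fun u : aff K (option 'I_10) => aff_part u i).
  by apply: eq_posfun (posfun_var (Some i)) => u; rewrite ffunE.
case: k => [|[|[|[|[|[|//]]]]]] _; rewrite /ec /e0_coord /A_coord /B_coord
  /C_coord /e_coord /with_coords; apply: posfun_vec10; split;
  by repeat first [ exact: pc | exact: px | exact: posfun1 | apply: posfunD
    | apply: posfunX | apply: posfunM | apply: posfunV ].
Qed.

Let C : chart (V1_var K) (@V1 K) (@V1_inv K) := (V1_chart_irreducible K).1.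

Lemma V1_birational :
  birational (torus K 'I_10) (V1_var K) (graph_on (torus K 'I_10) (@V1 K)).
Proof.
have rX : rational_map (torus K 'I_10) (V1_var K) (graph_on (torus K 'I_10) (@V1 K)).
  apply: (chart_rational_map (@chart_id K 'I_10) (P := fun=> True) (h := @V1 K)).
  - exact: popenT.
  - by exists [ffun=> 1] => // j; rewrite ffunE oner_neq0.
  - by move=> s; apply: sub_ratfun (chart_rat C s) => x [].
  - by move=> x Tx _; exact: (chart_in C).
  by move=> x w Tx; split=> -[].
split=> //; exists (rinv (graph_on (torus K 'I_10) (@V1 K))); split.
- apply: (chart_rational_map C (P := fun=> True) (h := fun x => x)) => //.
  - exact: popenT.
  - by exists [ffun=> 1] => // j; rewrite ffunE oner_neq0.
  - by move=> j; exact: ratfun_var.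
  move=> x y Tx; split; first by move=> [Ty /(V1_inj Tx Ty)].
  by move=> [_ ->].
- apply: (chart_ratmap_eq (@chart_id K 'I_10)); apply: genericT => x Tx.
  by exists x; split=> //; exists (V1 x).
apply: (chart_ratmap_eq C); apply: genericT => x Tx.
by exists (V1 x); split=> //; exists x.
Qed.

Lemma V1_positive_structure : positive_structure (V1_var K)
  (@V1_e K) (@V1_gamma K) (@V1_epsilon K) (@V1 K).
Proof.
split.
- exact: V1_birational.
- move=> i; rewrite Gm_times_torus.
  pose P u := ec_dom i (gm_part u) (@aff_part K _ u).
  apply: (posfun_positive_map (P := P)
    (f := fun u => ec i (gm_part u) (aff_part u))).
  + have [x Tx dx] := generic_ex (generic_ec_dom (ltn_ord i) (oner_neq0 K)).
    apply: (@popen_generic _ _ _ (apair 1 x)).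
    * apply: ec_dom_popen; [exact: ratfun_var|exact: ratmap_aff_part|].
      by move=> u /torus_optionE[].
    * by apply/torus_optionE; rewrite gm_part_pair aff_part_pair oner_neq0.
    by rewrite /P gm_part_pair aff_part_pair.
  + move=> u /torus_optionE[c0 Tx] Pu.
    have Te := ec_dom_torus (ltn_ord i) c0 Tx Pu.
    exists (V1 (ec i (gm_part u) (aff_part u))); last by [].
    by exists (V1 (aff_part u)) => //; apply/V1_eE.
  by move=> m; exact: posfun_ec (ltn_ord i).
- move=> i; apply: (posfun_positive_map (f := fun x => [ffun=> gam i x])
    (generic_structure_dom K (ltn_ord i))).
    move=> x Tx dx; exists (V1 x) => //.
    by apply/V1_gammaE => //; rewrite ffunE.
  move=> []; apply: eq_posfun (posfun_gam (ltn_ord i)) => x.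
  by rewrite ffunE.
move=> i; apply: (posfun_positive_map (f := fun x => [ffun=> eps i x])
  (generic_structure_dom K (ltn_ord i))).
  move=> x Tx dx; exists (V1 x) => //.
  by apply/V1_epsilonE => //; rewrite ffunE.
move=> []; apply: eq_posfun (posfun_eps (ltn_ord i)) => x.
by rewrite ffunE.
Qed.

(** The maps defined through [sigma_bar] exist only where [sigma_cond] holds, whereas the closed
    formulas may be defined on a larger set; hence equality on an open dense set. *)
Lemma V1_zero_structure :
  [/\ ratmap_eq (V1_var K) (@gamma0 K) (chart_fun (@V1 K) (@gamma0_coord K)),
      ratmap_eq (V1_var K) (@epsilon0 K)
        (chart_fun (@V1 K) (@epsilon0_coord K)) &
      forall c, c != 0 -> ratmap_eq (V1_var K) (e0 c)
        (chart_map (@V1 K) (@V1 K) (e0_coord c))].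
Proof.
split.
- apply: (chart_ratmap_eq C).
  apply: generic_imp (generic_structure_dom K (isT : (0 < 6)%N)) => x Tx sx.
  exists (gamma0_coord x); split; last by exists x.
  by apply/gamma0E => //; split=> //; apply/sigma_torusP.
- apply: (chart_ratmap_eq C).
  apply: generic_imp (generic_structure_dom K (isT : (0 < 6)%N)) => x Tx sx.
  exists (epsilon0_coord x); split; last by exists x.
  by apply/epsilon0E => //; split=> //; apply/sigma_torusP.
move=> c c0; apply: (chart_ratmap_eq C).
apply: generic_imp (generic_ec_dom (isT : (0 < 6)%N) c0) => x Tx dx.
have Te := ec_dom_torus (isT : (0 < 6)%N) c0 Tx dx.
exists (V1 (ec 0 c x)); split; last by exists x.
by apply/e0E => //; split=> //; split=> //; apply/sigma_torusP; case: dx.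
Qed.

End Positivity.

Theorem theorem2p4 (R : realType) :
  geometric_crystal D5_cartan (V1_var R[i])
    (@V1_e R[i]) (@V1_gamma R[i]) (@V1_epsilon R[i]) /\
  positive_structure (V1_var R[i])
    (@V1_e R[i]) (@V1_gamma R[i]) (@V1_epsilon R[i]) (@V1 R[i]) /\
  ratmap_eq (V1_var R[i]) (@gamma0 R[i])
    (chart_fun (@V1 R[i]) (@gamma0_coord R[i])) /\
  ratmap_eq (V1_var R[i]) (@epsilon0 R[i])
    (chart_fun (@V1 R[i]) (@epsilon0_coord R[i])) /\
  (forall c : R[i], c != 0 ->
     ratmap_eq (V1_var R[i]) (e0 c)
       (chart_map (@V1 R[i]) (@V1 R[i]) (e0_coord c))).
Proof.
have [g0 eps0 e0E'] := V1_zero_structure R[i].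
by split; [exact: V1_geometric_crystal | split=> //; exact: V1_positive_structure].
Qed.
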